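(* Let $m\ge 2$ be an integer, $a>0$, $\theta>1$, $\sigma>1$ real numbers, and let $Q$, $q$, $b_1,\dots,b_{m-1}$, $h$ be as in the context; in particular $$(-1)^m Q(r,t_0,\ldots,t_{m-1})\ \ge\ q(r)h(t_0)-\sum_{i=1}^{m-1}b_i(r)|t_i|$$ whenever $r\ge a$, $t_0>0$ and $(-1)^i t_i\ge 0$ for $i=1,\ldots,m-1$. Let $g$, $f$, $\mu$ be the functions defined in the context. Suppose that $$\int_0^1 g^{-1/m}(t)\,t^{1/m-1}\,dt<\infty$$ and $$\int_a^\infty \xi^{m-1} f(\xi)\,\mu^{1/m-1}(\xi)\,d\xi=\infty .$$ Then any non-trivial solution $w$ of the problem $$w^{(m)}=Q(r,w,\ldots,w^{(m-1)}),\quad r\ge a,\qquad (-1)^i w^{(i)}(r)\ge 0,\quad r\ge a,\ i=0,\ldots,m-1,$$ is singular of the first kind, i.e. $w$ vanishes identically in a neighborhood of infinity.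
   Context: Setting. $Q:[a,\infty)\times\mathbb R^m\to\mathbb R$ belongs to the Caratheodory class $K_{loc}([a,\infty)\times\mathbb R^m)$: $Q(\cdot,t)$ is measurable for every $t\in\mathbb R^m$, $Q(r,\cdot)$ is continuous for almost every $r$, and for every $\rho>0$ the function $r\mapsto\sup_{|t|\le\rho}|Q(r,t)|$ is integrable on every compact subinterval of $[a,\infty)$. The functions $q:[a,\infty)\to[0,\infty)$ and $b_i:[a,\infty)\to[0,\infty)$, $i=1,\ldots,m-1$, belong to $L_{\infty,loc}([a,\infty))$ (measurable and essentially bounded on compact subintervals), and $h:(0,\infty)\to(0,\infty)$ is continuous. Solutions. A function $w:[a,\infty)\to\mathbb R$ is a solution of the problem if $w^{(i)}$, $i=0,\ldots,m-1$, are locally absolutely continuous on $[a,\infty)$, the equation holds for almost all $r\in[a,\infty)$, and the sign conditions hold for all $r\in[a,\infty)$. A solution is non-trivial if it is not identically zero on $[a,\infty)$. A non-trivial solution is singular of the first kind if it vanishes in a neighborhood of infinity; otherwise it is called regular. Notation. For the fixed (arbitrarily chosen) real numbers $\theta>1$, $\sigma>1$: $$g(t)=\inf_{(t/\theta,\,\theta t)}h,\quad t\in(0,\infty),$$ $$f(r)=\frac{q(r)}{1+\sum_{i=1}^{m-1}r^{m-i}\,\operatorname{ess\,sup}_{(r/\sigma,\,r\sigma)\cap[a,\infty)}b_i},\quad r\in[a,\infty),$$ $$\mu(r)=1+r^m\,\operatorname{ess\,sup}_{(r/\sigma,\,r)\cap[a,\infty)}f,\quad r\in[a,\infty),$$ where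 the essential supremum over the empty set (occurring only at $r=a$ in the definition of $\mu$) is taken to be $0$. *)

(* Defs.v *)
From HB Require Import structures.
From mathcomp Require Import all_boot all_order all_algebra.
From mathcomp Require Import all_classical all_reals all_analysis.
From mathcomp Require Import ess_sup_inf.

Set Implicit Arguments.
Unset Strict Implicit.
Unset Printing Implicit Defensive.

Import Order.TTheory GRing.Theory Num.Theory.
Import numFieldNormedType.Exports.

Local Open Scope classical_set_scope.
Local Open Scope ring_scope.

(* "Measurable" and "almost everywhere" are meant in the sense of Lebesgue, not
   Borel: [lebR R] is R with the Lebesgue (completed) sigma-algebra.  It is
   convertible to R.  Functions on [a, oo) are total functions on R, and no
   definition below depends on their values on (-oo, a). *)
Notation lebR R := (caratheodory_type (wlength (@idfun R))^*%mu).
Notation leb R := (@completed_lebesgue_measure R).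

Section FunctionClasses.
Context {R : realType}.
Implicit Types (a c d theta : R) (f h : R -> R).

Definition leb_measurable_fun (D : set R) f :=
  @measurable_fun _ _ (lebR R) R D f.

(* The norm on 'rV[R]_m is the max norm; as rho ranges over all positive reals,
   any other norm on R^m gives the same class.  The supremum is extended-real:
   it may be +oo on the null set of r where Q r is not continuous. *)
Definition Caratheodory_loc m a (Q : R -> 'rV[R]_m -> R) :=
  [/\ forall t, leb_measurable_fun `[a, +oo[ (fun r => Q r t),
      {ae leb R, forall r : R, a <= r -> continuous (Q r)} &
      forall rho, 0 < rho -> forall c d, a <= c -> c <= d ->
        (leb R).-integrable `[c, d]
          (fun r : R =>
             ereal_sup [set `|Q r t|%:E | t in [set t | `|t| <= rho]])].

Definition Linfty_loc a f :=
  leb_measurable_fun `[a, +oo[ f /\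
  forall c d, a <= c -> c <= d ->
    exists M : R, {ae leb R, forall x : R, c <= x <= d -> `|f x| <= M}.

Definition abs_continuous_on c d f :=
  forall e : R, 0 < e -> exists2 delta : R, 0 < delta &
    forall (n : nat) (u v : 'I_n -> R),
      (forall i, [/\ c <= u i, u i <= v i & v i <= d]) ->
      trivIset [set: 'I_n] (fun i => `]u i, v i[%classic) ->
      \sum_(i < n) (v i - u i) < delta ->
      \sum_(i < n) `|f (v i) - f (u i)| < e.

Definition loc_abs_continuous a f :=
  forall c d, a <= c -> c <= d -> abs_continuous_on c d f.

(* Derivative of a function on [a, oo): the usual one for x > a, the right
   derivative for x = a. *)
Definition diff_quotient_filter a f (x : R) :=
  (fun y => (y - x)^-1 * (f y - f x)) @ within `[a, +oo[ x^'.

Definition derivable_from a f (x : R) := cvg (diff_quotient_filter a f x).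

Definition deriv_from a f (x : R) : R := lim (diff_quotient_filter a f x).

Definition derivn_from a (n : nat) f : R -> R := iter n (deriv_from a) f.

(* The essential supremum of f over D: the value -oo outside D never matters,
   and since fine -oo = 0 the value over the empty set is 0. *)
Definition ess_sup_on (D : set R) f : R :=
  fine (ess_sup (leb R) (patch (fun=> -oo%E) D (fun x => (f x)%:E))).

End FunctionClasses.

Section Problem.
Context {R : realType}.
Variables (m : nat) (a : R).
Implicit Types (w : R -> R).

Definition is_solution (Q : R -> 'rV[R]_m -> R) w :=
  [/\ forall i r, (i < m.-1)%N -> a <= r ->
        derivable_from a (derivn_from a i w) r,
      forall i, (i < m)%N -> loc_abs_continuous a (derivn_from a i w),
      {ae leb R, forall r : R, a <= r ->
        derivable_from a (derivn_from a m.-1 w) r /\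
        derivn_from a m w r = Q r (\row_(i < m) derivn_from a i w r)} &
      forall i r, (i < m)%N -> a <= r -> 0 <= (-1) ^+ i * derivn_from a i w r].

Definition nontrivial w := exists2 r, a <= r & w r != 0.

Definition singular_first_kind w :=
  nontrivial w /\ \forall r \near +oo, w r = 0.

Variables (theta sigma : R) (q : R -> R) (b : nat -> R -> R) (h : R -> R).

Definition g_fun (t : R) : R := inf (h @` `]t / theta, theta * t[).

Definition f_fun (r : R) : R :=
  q r / (1 + \sum_(1 <= i < m)
    r ^+ (m - i) * ess_sup_on (`]r / sigma, r * sigma[ `&` `[a, +oo[) (b i)).

Definition mu_fun (r : R) : R :=
  1 + r ^+ m * ess_sup_on (`]r / sigma, r[ `&` `[a, +oo[) f_fun.

End Problem.

(* Main.v *)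
Require Import Defs.
From HB Require Import structures.
From mathcomp Require Import all_boot all_order all_algebra.
From mathcomp Require Import all_classical all_reals all_analysis.
From mathcomp Require Import measurable_realfun ess_sup_inf ring lra.

(* Suppose that w never vanishes, so that w > 0 on [a, oo), and put
   W_k = (-1)^k w^(k) >= 0.  On a window [s, r] with r <= min(sigma, 2) s the Taylor
   sums T_i = sum_(k < i) (x - s)^k / k! W_k satisfy T_i' = -(x - s)^(i-1) / (i-1)! W_i.
   Adding suitable multiples of the lower ones to T_m absorbs the terms with b_i and
   gives, for f <= psi := q / D with a constant D and for every gam <= h(w) on [s, r],
     gam * int_s^r (x - s)^(m-1) psi <= (m-1)! (w(s) - w(r)).
   Let phi be the weight xi^(m-1) f mu^(1/m-1), or a simple function below it, and N(x)
   the essential supremum of f on (s, x).  Then phi N^((m-1)/m) <= psi and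
   phi <= N^(1/m) almost everywhere, so splitting [s, r] at the median of phi yields
   (1/2 int_s^r phi)^m <= int_s^r (x - s)^(m-1) psi.  Taking gam = g(t) for t between
   w(r) and w(s), these estimates bound int phi by a constant times the integral of
   g^(-1/m) t^(1/m-1) over [w(r), w(s)], provided that on the window either w drops by
   a fixed factor or x grows by a fixed factor.  A sequence of such windows exhausts
   [a, oo), and summation bounds int phi by the convergent integral of g, against the
   divergence of the integral of the weight. *)

(** The derivative w^(m) exists only almost everywhere, so the decrease of a Taylor sum is compared
    with the integral of its rate by an inequality, which absolute continuity and Fatou's lemma
    provide. The delicate windows are those on which w hardly drops: the estimate from g then
    carries a power of w(s) that w(s) - w(r) need not dominate. Convergence of the integral of g
    forces h(t) >= kap t on bounded ranges; fed into the window inequality, this makes the drop at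
    least proportional to w(s) times the integral of phi, which absorbs that power. Here the moment
    (x - s)^(m-1) has to be comparable with x^(m-1), which fails near s. Hence a window consists of
    two consecutive steps, and only the integral over the second one is kept; the windows overlap
    and their bounds telescope with a factor 2. A simple phi is measurable and bounded, as the
    median argument demands, whereas the weight is built from essential suprema over moving
    intervals. Likewise the constant denominator D turns f into the measurable majorant psi. *)

Set Implicit Arguments.
Unset Strict Implicit.
Unset Printing Implicit Defensive.

Import Order.TTheory GRing.Theory Num.Theory.
Import numFieldNormedType.Exports.

Local Open Scope classical_set_scope.
Local Open Scope ring_scope.

(** * Lebesgue measurability, null sets and almost-everywhere statements *)

Section Lebesgue.
Context {R : realType}.
Implicit Types (A : set R) (x y : R).

Lemma leb_measurable A : measurable A -> @measurable _ (lebR R) A.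
Proof.
by move=> mA; exact: (@sub_caratheodory _ (ocitv_type R) R (wlength idfun) A mA).
Qed.

Lemma leb_measurable_itv (i : interval R) : @measurable _ (lebR R) [set` i].
Proof. exact: leb_measurable (measurable_itv i). Qed.

Lemma leb_measurable_open A : open A -> @measurable _ (lebR R) A.
Proof. by move=> oA; exact: leb_measurable (open_measurable oA). Qed.

Lemma borel_leb_measurable_fun d (T : measurableType d) (D : set R) (f : R -> T) :
  measurable D -> measurable_fun D f -> @measurable_fun _ _ (lebR R) T D f.
Proof. by move=> mD mf _ Y mY; apply: leb_measurable; exact: mf. Qed.

Lemma leb_itv (i : interval R) :
  leb R [set` i] = (if i.1 < i.2 then (i.2 : \bar R) - i.1 else 0)%E.
Proof. exact: lebesgue_measure_itv. Qed.

Lemma leb_open_cover A (e : R) : (leb R).-negligible A -> 0 < e ->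
  exists U, [/\ open U, A `<=` U & (leb R U < e%:E)%E].
Proof.
move=> [B [_ B0 AB]] e0; have e2 : 0 < e / 2 by rewrite divr_gt0.
have [U [oU AU muU]] := outer_measure_open_le A e2.
exists U; split => //; apply: (@le_lt_trans _ _ (e / 2)%:E); last first.
  by rewrite lte_fin ltr_pdivrMr// mulr_natr mulr2n ltrDl.
apply: (le_trans muU); rewrite -[leRHS]add0e leeD2r//.
by rewrite -B0; exact: le_mu_ext.
Qed.

Lemma leb_itv_bnd (b1 b2 : bool) x y : x <= y ->
  leb R [set` Interval (BSide b1 x) (BSide b2 y)] = (y - x)%:E.
Proof.
rewrite leb_itv/= lte_fin le_eqVlt => /orP[/eqP ->|->//].
by rewrite ltxx subrr.
Qed.

Lemma leb_negligible1 x : (leb R).-negligible [set x].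
Proof.
exists `[x, x]%classic; split; first exact: leb_measurable_itv.
  by have := @leb_itv `[x, x]; rewrite /= lte_fin ltxx.
by move=> _ ->; rewrite /= in_itv/= lexx.
Qed.

Lemma leb_aeW (P : R -> Prop) : (forall x, P x) -> {ae leb R, forall x : R, P x}.
Proof. by move=> HP; apply: negligibleS (leb_negligible1 0) => x /=. Qed.

Lemma leb_aeS (P Q : R -> Prop) : (forall x, P x -> Q x) ->
  {ae leb R, forall x : R, P x} -> {ae leb R, forall x : R, Q x}.
Proof. by move=> PQ; apply: negligibleS => x /= nQ /PQ. Qed.

Lemma leb_aeI (P Q : R -> Prop) : {ae leb R, forall x : R, P x} ->
  {ae leb R, forall x : R, Q x} -> {ae leb R, forall x : R, P x /\ Q x}.
Proof.
move=> nP nQ; apply: negligibleS (negligibleU nP nQ) => x /= nPQ.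
by have [Px|] := pselect (P x); [right => Qx; apply: nPQ|left].
Qed.

Lemma leb_ae_forall (P : nat -> R -> Prop) :
  (forall i, {ae leb R, forall x : R, P i x}) ->
  {ae leb R, forall x : R, forall i, P i x}.
Proof.
move=> nP; apply: negligibleS (negligible_bigcup nP) => x /= /existsNP[i nPi].
by exists i.
Qed.

End Lebesgue.
#[export] Hint Extern 0 (measurable _) => solve [exact: leb_measurable_itv] : core.

(** * Induction along a compact interval *)

Section RealInduction.
Context {R : realType}.
Variables (c d : R) (P : R -> Prop).
Hypotheses (cd : c <= d) (Pc : P c).
Hypothesis local : forall x, c <= x <= d -> exists2 eta : R, 0 < eta &
  forall y z, x - eta < y -> y <= x -> x <= z -> z < x + eta ->
    c <= y -> z <= d -> P y -> P z.

(** The supremum of the points satisfying [P] need not be known to satisfy it, so [local] has to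
    jump over it, from a point [y] on its left to a point [z] on its right. *)
Lemma real_induction : P d.
Proof.
pose A := [set x | c <= x <= d /\ P x].
have Ac : A c by rewrite /A/= lexx cd.
have supA : has_sup A by split; [exists c|exists d => x [/andP[]]].
pose s := sup A.
have cs : c <= s by apply: ub_le_sup => //; exact: supA.2.
have sd : s <= d by apply: ge_sup; [exists c|move=> x [/andP[]]].
have [|eta eta0 H] := local (x := s); first by rewrite cs sd.
have [y [/andP[cy yd] Py] sy] := sup_adherent eta0 supA.
have ys : y <= s by apply: ub_le_sup; [exact: supA.2|rewrite /A/= cy yd].
have [ds|sd'] := leP d s.
  by apply: (H y) => //; rewrite ?(le_lt_trans ds)// ltrDl.
pose z := Num.min d (s + eta / 2).
have sz : s < z by rewrite lt_min sd' ltrDl divr_gt0.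
have zd : z <= d by rewrite ge_min lexx.
suff Az : A z by have := ub_le_sup supA.2 Az; rewrite leNgt sz.
split; first by rewrite zd (le_trans cs (ltW sz)).
apply: (H y) => //; first exact: ltW.
by rewrite gt_min ltrD2l ltr_pdivrMr// mulr_natr mulr2n ltrDl eta0 orbT.
Qed.

End RealInduction.

(** * Monotonicity from slope bounds that hold almost everywhere *)

Section SlopeBounds.
Context {R : realType}.
Implicit Types (S : R -> R) (c d x l : R).

(* An upper bound for the slopes of the chords over small intervals containing
   x; unlike a bound on difference quotients at x, it is stated in the form that
   interval subdivisions need. *)
Definition slope_le S x l := forall e : R, 0 < e -> exists2 eta : R, 0 < eta &
  forall y z, x - eta < y -> y <= x -> x <= z -> z < x + eta ->
    S z - S y <= (l + e) * (z - y).

(* The increase of S over [c, x] is bounded by the slope e plus the jumps of S over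
   disjoint intervals of total length at most that of U; absolute continuity
   controls these jumps when U is a small neighbourhood of the exceptional null set. *)
Definition chain S (U : set R) (e : R) c x := exists n (u v : nat -> R),
  [/\ forall i, (i < n)%N -> [/\ c <= u i, u i <= v i & v i <= x],
      forall i j, (i < j < n)%N -> v i <= u j,
      ((\sum_(i < n) (v i - u i))%:E <= leb R (U `&` `]c, x[))%E &
      S x - S c <= e * (x - c) + \sum_(i < n) `|S (v i) - S (u i)|].

Lemma chain_slope S U e c y z : c <= y -> y <= z ->
  S z - S y <= e * (z - y) -> @measurable _ (lebR R) U -> chain S U e c y -> chain S U e c z.
Proof.
move=> cy yz Syz mU [n [u [v [H1 H2 H3 H4]]]]; exists n, u, v; split => //.
- by move=> i /H1[? ? ?]; split => //; exact: le_trans yz.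
- apply: (le_trans H3); apply: le_measure; rewrite ?inE.
  + by apply: measurableI => //; exact: leb_measurable_itv.
  + by apply: measurableI => //; exact: leb_measurable_itv.
  + by apply: setIS => x /=; rewrite !in_itv/= => /andP[-> /lt_le_trans]; apply.
- by lra.
Qed.

(** The new jump is paid for by []y, z[], a part of [U] disjoint from []c, y[], which paid for the
    earlier jumps. *)
Lemma chain_jump S U e c y z : c <= y -> y <= z -> 0 <= e ->
  `]y, z[ `<=` U -> @measurable _ (lebR R) U -> chain S U e c y ->
  chain S U e c z.
Proof.
move=> cy yz e0 yzO mU [n [u [v [H1 H2 H3 H4]]]].
exists n.+1, (fun i => if (i < n)%N then u i else y),
  (fun i => if (i < n)%N then v i else z); split.
- move=> i _; case: ifPn => [/H1[? ? ?]|_]; split => //.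
  exact: le_trans yz.
- move=> i j /andP[ij jn]; have -> : (i < n)%N by rewrite (leq_trans ij).
  case: ifPn => [jn'|_]; first by apply: H2; rewrite ij jn'.
  by have [] := H1 i (leq_trans ij jn).
- rewrite big_ord_recr/= ltnn.
  under eq_bigr do rewrite ltn_ord.
  apply: (@le_trans _ _ (leb R ((U `&` `]c, y[) `|` `]y, z[)))%E; last first.
    apply: le_measure; rewrite ?inE.
    + apply: measurableU; last exact: leb_measurable_itv.
      by apply: measurableI => //; exact: leb_measurable_itv.
    + by apply: measurableI => //; exact: leb_measurable_itv.
    + move=> x [[Ox]|xyz].
        by rewrite /= !in_itv/= => /andP[cx xy]; rewrite cx (lt_le_trans xy).
      split; first exact: yzO.
      move: xyz; rewrite /= !in_itv/= => /andP[yx ->].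
      by rewrite (le_lt_trans cy).
  rewrite measureU.
  + by rewrite EFinD; apply: leeD => //; have := leb_itv_bnd false true yz => /= ->.
  + by apply: measurableI => //; exact: leb_measurable_itv.
  + exact: leb_measurable_itv.
  + rewrite -subset0 => x [[_]]; rewrite /= !in_itv/= => /andP[_ xy] /andP[yx _].
    by have := lt_trans xy yx; rewrite ltxx.
- rewrite big_ord_recr/= ltnn.
  under eq_bigr do rewrite ltn_ord.
  have h1 := ler_norm (S z - S y).
  have h2 : e * (y - c) <= e * (z - c) by rewrite ler_wpM2l// lerD2r.
  lra.
Qed.

(** Induction along the interval on [chain]: exceptional points are crossed by a jump inside a small
    open cover, all others with slope [e / k]. *)
Lemma ac_slope_le0 S c d : c <= d -> abs_continuous_on c d S ->
  {ae leb R, forall x : R, c < x < d -> slope_le S x 0} -> S d <= S c.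
Proof.
move=> cd acS aeS; rewrite -subr_le0; apply/ler_addgt0Pr => e e0.
rewrite add0r.
(* Slope [e / k] over the length [d - c], plus jumps of total size below [e / k], add up to at most
   [e]. *)
pose k := (d - c) + 1.
have k0 : 0 < k by rewrite /k ltr_wpDl// subr_ge0.
have ek0 : 0 < e / k by rewrite divr_gt0.
have [delta delta0 Hdelta] := acS _ ek0.
(* The endpoints, where no slope bound is given, are crossed by jumps too. *)
have negN : (leb R).-negligible
   ([set x | ~ (c < x < d -> slope_le S x 0)] `|` [set c; d]).
  by apply: negligibleU => //; apply: negligibleU; exact: leb_negligible1.
have [U [oU NU muU]] := leb_open_cover negN delta0.
have mU := leb_measurable_open oU.
suff: chain S U (e / k) c d.
  move=> [n [u [v [H1 H2 H3 H4]]]].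
  have H5 : \sum_(i < n) `|S (v i) - S (u i)| < e / k.
    apply: (Hdelta n (fun i => u i) (fun i => v i)).
    - by move=> i; apply: H1.
    - apply/trivIsetP => i j _ _; wlog : i j / (i < j)%N.
        move=> W ij; case: (ltngtP i j) => [/W->//|ji|/val_inj ij'].
          by rewrite setIC; apply: W => //; rewrite eq_sym.
        by rewrite ij' eqxx in ij.
      move=> ij _; have vu : v i <= u j by apply: H2; rewrite ij ltn_ord.
      rewrite -subset0 => x []; rewrite /= !in_itv/= => /andP[_ xv] /andP[ux _].
      by have := lt_le_trans xv (le_trans vu (ltW ux)); rewrite ltxx.
    - rewrite -lte_fin; apply: le_lt_trans muU; apply: (le_trans H3).
      apply: le_measure; rewrite ?inE//.
      by apply: measurableI => //; exact: leb_measurable_itv.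
  apply: (le_trans H4); have ek : e / k * k = e by rewrite divfK// gt_eqF.
  by move: ek H5; rewrite {2}/k; move: (e / k) => t; lra.
apply: (@real_induction _ c d (chain S U (e / k) c)) => //.
  exists 0%N, (fun=> c), (fun=> c); split => //.
  - by rewrite big_ord0; exact: measure_ge0.
  - by rewrite big_ord0 subrr; lra.
move=> x /andP[cx xd].
have [xN|xN] := pselect (([set x | ~ (c < x < d -> slope_le S x 0)] `|` [set c; d]) x).
  have := oU; rewrite openE => /(_ _ (NU _ xN)) /nbhs_ballP[eta /= eta0 xO].
  exists eta => // y z xy yx xz zx cy zd Py.
  apply: chain_jump Py => //; first exact: le_trans xz.
    exact: ltW.
  move=> t; rewrite /= in_itv/= => /andP[yt tz]; apply: xO.
  rewrite /ball/= ltr_norml; apply/andP; split; lra.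
have [cNx xNd] : c != x /\ x != d.
  by split; apply/eqP => E; apply: xN; right; [left|right].
have cxd : c < x < d by rewrite !lt_neqAle cx xd cNx xNd.
have : slope_le S x 0.
  by apply: contrapT => Sx; apply: xN; left => /(_ cxd).
move=> /(_ _ ek0)[eta eta0 Heta].
exists eta => // y z xy yx xz zx cy zd.
apply: chain_slope => //; first exact: le_trans xz.
by have := Heta _ _ xy yx xz zx; rewrite add0r.
Qed.

End SlopeBounds.

(** * Closure properties of absolutely continuous functions *)

Section AbsoluteContinuity.
Context {R : realType}.
Implicit Types (S f g : R -> R) (c d : R).

Lemma ac_sub c d c' d' f : c <= c' -> d' <= d ->
  abs_continuous_on c d f -> abs_continuous_on c' d' f.
Proof.
move=> cc dd acf e /acf[delta delta0 H]; exists delta => // n u v Huv.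
by apply: H => i; have [? ? ?] := Huv i; split => //; [exact: le_trans cc _|exact: le_trans dd].
Qed.

Lemma ac_lipschitz c d f (K : R) :
  (forall x y, c <= x -> x <= y -> y <= d -> `|f y - f x| <= K * (y - x)) ->
  abs_continuous_on c d f.
Proof.
move=> Kf e e0; have K0 : 0 < `|K| + 1 by rewrite ltr_wpDl.
exists (e / (`|K| + 1)); first by rewrite divr_gt0.
move=> n u v Huv _; rewrite ltr_pdivlMr// => /(le_lt_trans _); apply.
rewrite mulr_suml; apply: ler_sum => i _; have [cu uv vd] := Huv i.
apply: (le_trans (Kf _ _ cu uv vd)); rewrite mulrC ler_wpM2l ?subr_ge0//.
by rewrite (le_trans (ler_norm _))// lerDl.
Qed.

Lemma ac_cst c d (k : R) : abs_continuous_on c d (fun=> k).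
Proof. by apply: (@ac_lipschitz _ _ _ 0) => x y _ _ _; rewrite subrr normr0 mul0r. Qed.

Lemma acD c d f g : abs_continuous_on c d f -> abs_continuous_on c d g ->
  abs_continuous_on c d (fun x => f x + g x).
Proof.
move=> acf acg e e0; have e2 : 0 < e / 2 by rewrite divr_gt0.
have [df df0 Hf] := acf _ e2; have [dg dg0 Hg] := acg _ e2.
exists (Num.min df dg); first by rewrite lt_min df0.
move=> n u v Huv tuv; rewrite lt_min => /andP[/(Hf n u v Huv tuv) f2 /(Hg n u v Huv tuv) g2].
apply: (@le_lt_trans _ _ (\sum_(i < n) (`|f (v i) - f (u i)| + `|g (v i) - g (u i)|))).
  by apply: ler_sum => i _; rewrite opprD addrACA ler_normD.
rewrite big_split/=; lra.
Qed.

Lemma ac_sum c d n (f : nat -> R -> R) :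
  (forall i, (i < n)%N -> abs_continuous_on c d (f i)) ->
  abs_continuous_on c d (fun x => \sum_(i < n) f i x).
Proof.
elim: n => [|n IH] H.
  by rewrite (_ : (fun x => _) = fun=> 0) ?funeqE => [|x]; [exact: ac_cst|rewrite big_ord0].
rewrite (_ : (fun x => _) = fun x => \sum_(i < n) f i x + f n x); last first.
  by apply/funext => x; rewrite big_ord_recr.
by apply: acD; [apply: IH => i /ltnW; exact: H|exact: H].
Qed.

Lemma ac_modulus1 c d f (e : R) : 0 < e -> abs_continuous_on c d f ->
  exists2 delta : R, 0 < delta & forall x y, c <= x -> x <= y -> y <= d ->
    y - x < delta -> `|f y - f x| < e.
Proof.
move=> e0 /(_ _ e0)[delta delta0 H]; exists delta => // x y cx xy yd xyd.
have := H 1%N (fun=> x) (fun=> y); rewrite !big_ord1; apply => //.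
by apply/trivIsetP => i j _ _; rewrite !ord1 eqxx.
Qed.

Lemma ac_bounded c d f : c <= d -> abs_continuous_on c d f ->
  exists M, forall x, c <= x <= d -> `|f x| <= M.
Proof.
move=> cd acf; have [eta eta0 Heta] := ac_modulus1 ltr01 acf.
apply: (@real_induction _ c d (fun y => exists M, forall x, c <= x <= y -> `|f x| <= M)) => //.
  by exists `|f c| => x xc; rewrite (_ : x = c)//; apply/eqP; rewrite eq_le andbC.
(* Points within [eta / 2] of [x] are less than [eta] apart, so the bound grows by at most 1 across
   [x]. *)
move=> x /andP[cx xd]; exists (eta / 2); first by rewrite divr_gt0.
move=> y z xy yx xz zx cy zd [M HM]; exists (M + 1) => t /andP[ct tz].
have [ty|yt] := leP t y; first by rewrite (le_trans (HM t _)) ?ct// lerDl.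
have h1 : `|f t - f y| < 1 by apply: Heta; rewrite ?(ltW yt)//; [exact: le_trans zd|lra].
have h2 : `|f y| <= M by apply: HM; rewrite cy lexx.
by rewrite -(subrK (f y) (f t)) (le_trans (ler_normD _ _))//; lra.
Qed.

Lemma acM c d f g : c <= d -> abs_continuous_on c d f -> abs_continuous_on c d g ->
  abs_continuous_on c d (fun x => f x * g x).
Proof.
move=> cd acf acg e e0.
have [M HM] := ac_bounded cd acf; have [N HN] := ac_bounded cd acg.
have M1 : 0 < `|M| + 1 by rewrite ltr_wpDl.
have N1 : 0 < `|N| + 1 by rewrite ltr_wpDl.
have eM : 0 < e / 2 / (`|M| + 1) by rewrite !divr_gt0.
have eN : 0 < e / 2 / (`|N| + 1) by rewrite !divr_gt0.
have [df df0 Hf] := acf _ eN; have [dg dg0 Hg] := acg _ eM.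
exists (Num.min df dg); first by rewrite lt_min df0.
move=> n u v Huv tuv; rewrite lt_min => /andP[/(Hf n u v Huv tuv) f2 /(Hg n u v Huv tuv) g2].
apply: (@le_lt_trans _ _ (\sum_(i < n) ((`|M| + 1) * `|g (v i) - g (u i)|
    + (`|N| + 1) * `|f (v i) - f (u i)|))).
  apply: ler_sum => i _; have [cu uv vd] := Huv i.
  have fM : `|f (u i)| <= `|M| + 1.
    by rewrite (le_trans (HM _ _)) ?cu ?(le_trans uv)// ler_wpDr// ler_norm.
  have gN : `|g (v i)| <= `|N| + 1.
    by rewrite (le_trans (HN _ _)) ?vd ?(le_trans cu)// ler_wpDr// ler_norm.
  rewrite (_ : _ - _ = f (u i) * (g (v i) - g (u i)) + g (v i) * (f (v i) - f (u i))); last by ring.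
  by rewrite (le_trans (ler_normD _ _))// !normrM lerD// ler_wpM2r.
rewrite big_split/= -!mulr_sumr.
move: f2 g2; rewrite !ltr_pdivlMr// ![_ * (_ + 1)]mulrC; lra.
Qed.

Lemma ac_continuous c d f : abs_continuous_on c d f -> {within `[c, d], continuous f}.
Proof.
move=> acf; apply/subspace_continuousP.
move=> x; rewrite /= in_itv/= => /andP[cx xd].
apply/cvgrPdist_lt => e e0; have [delta delta0 H] := ac_modulus1 e0 acf.
near=> y.
have : y \in `[c, d] by near: y; exact: withinT.
rewrite in_itv/= => /andP[cy yd].
have : `|x - y| < delta by near: y; apply: cvg_within; exact: nbhsx_ballx.
have [xy|/ltW yx] := leP x y.
- by rewrite distrC ger0_norm ?subr_ge0// => xyd; rewrite distrC; apply: H.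
- by rewrite ger0_norm ?subr_ge0// => xyd; apply: H.
Unshelve. all: by end_near. Qed.

End AbsoluteContinuity.

(** * Difference quotients on grids and the integral of a rate of decrease *)

Lemma measurable_fun_limn_einf d (T : measurableType d) (R : realType) (D : set T)
    (f : (T -> \bar R)^nat) : (forall n, measurable_fun D (f n)) ->
  measurable_fun D (fun x => limn_einf (f ^~ x)).
Proof.
move=> mf; apply: measurableT_comp => //; apply: measurable_fun_limn_esup => n.
exact: measurableT_comp.
Qed.

Section DifferenceQuotients.
Context {R : realType}.
Implicit Types (S p : R -> R) (s r x : R).

Definition gridpt s r n i : R := s + i%:R * ((r - s) / n.+1%:R).

(** The sign makes this a rate of decrease, nonnegative for nonincreasing [S]. *)
Definition chord_slope S s r n i : R :=
  (S (gridpt s r n i) - S (gridpt s r n i.+1)) / ((r - s) / n.+1%:R).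

Definition stair S s r n x : R := \sum_(i < n.+1)
  chord_slope S s r n i * \1_(`]gridpt s r n i, gridpt s r n i.+1] : set R) x.

Lemma gridptS s r n i : gridpt s r n i.+1 = gridpt s r n i + (r - s) / n.+1%:R.
Proof. by rewrite /gridpt -natr1; ring. Qed.

Lemma gridpt_last s r n : gridpt s r n n.+1 = r.
Proof. by rewrite /gridpt mulrC divfK ?pnatr_eq0// addrC subrK. Qed.

Lemma step_gt0 s r n : s < r -> 0 < (r - s) / n.+1%:R.
Proof. by move=> sr; rewrite divr_gt0// ?subr_gt0. Qed.

Lemma gridpt_itv s r n i : s < r -> (i <= n.+1)%N -> s <= gridpt s r n i <= r.
Proof.
move=> sr iln; rewrite {1}/gridpt lerDl mulr_ge0 ?(ltW (step_gt0 n sr))//=.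
by rewrite -[leRHS](gridpt_last s r n) /gridpt lerD2l ler_pM2r ?step_gt0// ler_nat.
Qed.

Lemma gridpt_cover s r n x : s < r -> s < x < r ->
  exists2 i, (i < n.+1)%N & gridpt s r n i < x <= gridpt s r n i.+1.
Proof.
move=> sr /andP[sx xr].
have ex : exists k, x <= gridpt s r n k by exists n.+1; rewrite gridpt_last ltW.
case: (ex_minnP ex) => -[|k] xk mink.
  by move: xk; rewrite /gridpt mul0r addr0 leNgt sx.
have kn : (k.+1 <= n.+1)%N by apply: mink; rewrite gridpt_last ltW.
exists k => //; rewrite xk andbT ltNge; apply/negP => /mink; by rewrite ltnn.
Qed.

Section Nonincreasing.
Variables (S : R -> R) (s r : R).
Hypothesis sr : s < r.
Hypothesis S_ni : forall x y, s <= x -> x <= y -> y <= r -> S y <= S x.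

Lemma chord_slope_ge0 n i : (i < n.+1)%N -> 0 <= chord_slope S s r n i.
Proof.
move=> iln; rewrite divr_ge0// ?(ltW (step_gt0 _ _))// subr_ge0.
have /andP[h1 h2] := gridpt_itv sr iln; have /andP[h3 h4] := gridpt_itv sr (ltnW iln).
by apply: S_ni => //; rewrite gridptS lerDl ltW// step_gt0.
Qed.

Lemma stair_ge0 n x : 0 <= stair S s r n x.
Proof. by apply: sumr_ge0 => i _; rewrite mulr_ge0// chord_slope_ge0. Qed.

Lemma stair_ge n i x : (i < n.+1)%N -> gridpt s r n i < x <= gridpt s r n i.+1 ->
  chord_slope S s r n i <= stair S s r n x.
Proof.
move=> iln xi; rewrite /stair (bigD1 (Ordinal iln))//= indicE mem_set ?mulr1//.
by rewrite lerDl sumr_ge0// => j _; rewrite mulr_ge0// chord_slope_ge0.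
Qed.

Lemma measurable_stair n (D : set R) : measurable_fun (D : set (lebR R)) (stair S s r n).
Proof.
by apply: measurable_sum => i; apply: measurable_funM => //.
Qed.

Lemma integral_stair n :
  (\int[leb R]_(x in `]s, r[) (stair S s r n x)%:E <= (S s - S r)%:E)%E.
Proof.
pose F i (x : lebR R) := (chord_slope S s r n i * \1_(`]gridpt s r n i, gridpt s r n i.+1] : set R) x)%:E.
have -> : (\int[leb R]_(x in `]s, r[) (stair S s r n x)%:E =
    \int[leb R]_(x in `]s, r[) (\sum_(i < n.+1) F i x))%E.
  by apply: eq_integral => x _; rewrite /stair sumEFin.
have Fge0 i x : (i < n.+1)%N -> (0 <= F i x)%E.
  by move=> iln; rewrite lee_fin mulr_ge0// chord_slope_ge0.
have mF i (D : set R) : measurable_fun (D : set (lebR R)) (F i).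
  apply/measurable_EFinP; exact: measurable_funM.
rewrite ge0_integral_sum//; last by move=> i x _; exact: Fge0.
have -> : S s - S r = \sum_(i < n.+1) (S (gridpt s r n i) - S (gridpt s r n i.+1)).
  rewrite -(big_mkord xpredT (fun i => S (gridpt s r n i) - S (gridpt s r n i.+1))).
  under eq_bigr do rewrite -opprB.
  rewrite sumrN telescope_sumr// opprB gridpt_last.
  by rewrite {1}/gridpt mul0r addr0.
rewrite -sumEFin; apply: lee_sum => i _.
rewrite /F; under eq_integral do rewrite EFinM.
rewrite ge0_integralZl_EFin; last 4 first.
- exact: leb_measurable_itv.
- by move=> x _; rewrite lee_fin.
- exact/measurable_EFinP.
- exact: chord_slope_ge0.
rewrite integral_indic//.
have -> : S (gridpt s r n i) - S (gridpt s r n i.+1) =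
    chord_slope S s r n i * ((r - s) / n.+1%:R).
  by rewrite divfK// gt_eqF// step_gt0.
rewrite [leRHS]EFinM.
apply: lee_wpmul2l; first by rewrite lee_fin chord_slope_ge0.
apply: (@le_trans _ _ (leb R `]gridpt s r n i, gridpt s r n i.+1]%classic)).
  by apply: le_measure; rewrite ?inE//; exact: measurableI.
rewrite gridptS leb_itv_bnd ?lerDl ?(ltW (step_gt0 _ _))//.
by rewrite lee_fin addrAC subrr add0r.
Qed.

End Nonincreasing.

(* Fatou's lemma for the difference quotients along finer and finer grids. *)
Lemma integral_le_decrease S p s r : s < r -> abs_continuous_on s r S ->
  leb_measurable_fun `]s, r[ p -> (forall x, s < x < r -> 0 <= p x) ->
  {ae leb R, forall x : R, s < x < r -> slope_le S x (- p x)} ->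
  (\int[leb R]_(x in `]s, r[) (p x)%:E <= (S s - S r)%:E)%E.
Proof.
move=> sr acS mp p0 aeS.
(* Since [- p] is nonpositive, the slope bound already makes [S] nonincreasing, and the stair
   functions are nonnegative as Fatou's lemma requires. *)
have S_ni x y : s <= x -> x <= y -> y <= r -> S y <= S x.
  move=> sx xy yr; apply: ac_slope_le0 => //; first exact: ac_sub acS.
  apply: leb_aeS aeS => z H /andP[xz zy] e e0.
  have szr : s < z < r by rewrite (le_lt_trans sx)//= (lt_le_trans zy).
  have [eta eta0 Heta] := H szr _ e0; exists eta => // u v *.
  rewrite (le_trans (Heta u v _ _ _ _))// ler_wpM2r ?lerD2r ?oppr_le0 ?p0//.
  by rewrite subr_ge0 (le_trans (y := z)).
have mitv : @measurable _ (lebR R) `]s, r[%classic by exact: leb_measurable_itv.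
have mst n : measurable_fun (`]s, r[%classic : set (lebR R)) (fun x => (stair S s r n x)%:E).
  by apply/measurable_EFinP; exact: measurable_stair.
have st0 n (x : lebR R) : `]s, r[%classic x -> (0 <= (stair S s r n x)%:E)%E.
  by move=> _; rewrite lee_fin stair_ge0.
apply: (@le_trans _ _ (\int[leb R]_(x in `]s, r[) limn_einf (fun n => (stair S s r n x)%:E))%E).
  apply: ae_ge0_le_integral.
  - exact: mitv.
  - by move=> x; rewrite /= in_itv/= => /p0; rewrite lee_fin.
  - exact/measurable_EFinP.
  - move=> x sxr; rewrite limn_einf_lim; apply: lime_ge; first exact: is_cvg_einfs.
    by apply: nearW => n; apply: le_ereal_inf_tmp => _ [k _ <-]; exact: st0.
  - exact: measurable_fun_limn_einf.
  apply: leb_aeS aeS => x H; rewrite /= in_itv/= => sxr.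
  have /andP[sx xr] := sxr.
  apply/lee_addgt0Pr => e e0; rewrite -leeBlDr//.
  rewrite limn_einf_lim; apply: lime_ge; first exact: is_cvg_einfs.
  (* A grid cell that contains [x] and is shorter than [eta] has chord slope at least [p x - e]. *)
  have [eta eta0 Heta] := H sxr _ e0.
  have [N _ HN] : \forall n \near \oo, n.+1%:R^-1 < eta / (r - s).
    by apply: near_infty_natSinv_lt (PosNum (divr_gt0 eta0 _)); rewrite subr_gt0.
  exists N => // n /= Nn; apply: le_ereal_inf_tmp => _ [k /= nk <-].
  have [i iln xi] := gridpt_cover k sr sxr.
  rewrite -EFinD lee_fin.
  apply: le_trans (stair_ge sr S_ni iln xi).
  have /andP[gx xg] := xi.
  have h0 := step_gt0 k sr.
  have heta : (r - s) / k.+1%:R < eta.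
    have := HN k (leq_trans Nn nk); rewrite /= ltr_pdivlMr ?subr_gt0//.
    by rewrite mulrC.
  rewrite /chord_slope ler_pdivlMr//.
  have := Heta (gridpt s r k i) (gridpt s r k i.+1).
  rewrite gridptS in xg *; move: (gridpt s r k i) gx xg => g gx xg.
  move: ((r - s) / k.+1%:R) h0 heta xg => h h0 heta xg.
  move=> /(_ _ (ltW gx) xg); rewrite (_ : (- p x + e) * (g + h - g) = - ((p x - e) * h)); last by ring.
  by move=> H'; have := H' _ _; rewrite -lerN2 opprK opprB; apply; lra.
apply: le_trans (fatou _ _ _ _) _ => //.
rewrite limn_einf_lim; apply: lime_le; first exact: is_cvg_einfs.
apply: nearW => n; apply: le_trans (integral_stair sr S_ni n).
by apply: ereal_inf_lbound; exists n => /=.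
Qed.

End DifferenceQuotients.

(** * Derivatives and Taylor sums *)

Section Derivatives.
Context {R : realType}.
Implicit Types (f S : R -> R) (a s x l : R).

Lemma slope_le_trans S x l l' : l <= l' -> slope_le S x l -> slope_le S x l'.
Proof.
move=> ll' H e e0; have [eta eta0 Heta] := H _ e0; exists eta => // y z h1 h2 h3 h4.
rewrite (le_trans (Heta y z h1 h2 h3 h4))// ler_wpM2r ?lerD2r//.
by rewrite subr_ge0 (le_trans h2).
Qed.

(** A chord over an interval containing [x] splits at [x] into two chords ending there, each
    controlled by the difference quotient at [x]. *)
Lemma is_derive_slope_le S x l : is_derive x 1 S l -> slope_le S x l.
Proof.
move=> [dS Sl] e e0.
have : h^-1 *: (S (h *: 1 + x) - S x) @[h --> 0^'] --> l.
  by rewrite -Sl; exact: dS.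
move=> /cvgrPdist_le /(_ _ e0) /nbhs_ballP[eta /= eta0 Heta].
have H h : `|h| < eta -> `|S (x + h) - S x - l * h| <= e * `|h|.
  have [->|h0] := eqVneq h 0; first by rewrite addr0 subrr mulr0 subr0 normr0 mulr0.
  move=> heta; have := Heta h; rewrite /ball/= sub0r normrN => /(_ heta h0).
  rewrite /GRing.scale/= mulr1 [h + x]addrC => Hh.
  have -> : S (x + h) - S x - l * h = - ((l - h^-1 * (S (x + h) - S x)) * h).
    by rewrite mulrBl mulrAC mulVf// mul1r opprB.
  by rewrite normrN normrM ler_wpM2r.
exists eta => // y z xy yx xz zx.
have H1 := H (y - x); have H2 := H (z - x).
rewrite !(addrC x) !subrK in H1 H2.
rewrite ler0_norm ?subr_le0// in H1; rewrite ger0_norm ?subr_ge0// in H2.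
have /ler_normlP[H1' _] : `|S y - S x - l * (y - x)| <= e * - (y - x) by apply: H1; lra.
have /ler_normlP[_ H2'] : `|S z - S x - l * (z - x)| <= e * (z - x) by apply: H2; lra.
lra.
Qed.

Lemma derivable_from_is_derive a f x : a < x -> derivable_from a f x ->
  is_derive x 1 f (deriv_from a f x).
Proof.
move=> ax dfx.
suff H : h^-1 *: (f (h *: 1 + x) - f x) @[h --> 0^'] --> deriv_from a f x.
  have dx : derivable f x 1 by apply/cvg_ex; exists (deriv_from a f x).
  by apply: DeriveDef => //; exact/cvg_lim.
apply/cvgrPdist_le => e e0.
have /cvgrPdist_le/(_ _ e0) : diff_quotient_filter a f x --> deriv_from a f x.
  exact: dfx.
rewrite /within /= => /nbhs_ballP[eta /= eta0 Heta].
apply/nbhs_ballP; exists (Num.min eta (x - a)) => /=.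
  by rewrite lt_min eta0 subr_gt0.
move=> h; rewrite /ball/= sub0r normrN lt_min => /andP[heta hxa] h0.
have := Heta (h + x); rewrite /ball/= opprD addrCA subrr addr0 normrN => /(_ heta).
rewrite addrK /GRing.scale/= mulr1; apply.
  by apply/eqP => E; move/eqP: h0; apply; rewrite -(addrK x h) E subrr.
rewrite in_itv/= andbT; move: hxa; rewrite ltr_norml => /andP[]; lra.
Qed.

Definition taylor_term s i x : R := (x - s) ^+ i / i`!%:R.

Lemma is_derive_taylor_term s i x :
  is_derive x 1 (taylor_term s i.+1) (taylor_term s i x).
Proof.
have -> : taylor_term s i.+1 = (i.+1)`!%:R^-1 *: (fun y : R => y - s) ^+ i.+1.
  by apply/funext => y; rewrite /taylor_term fctE/= mulrC.
apply: is_derive_eq.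
rewrite /taylor_term /GRing.scale/= subr0 factS natrM.
have i0 : i.+1%:R != 0 :> R by rewrite pnatr_eq0.
have f0 : i`!%:R != 0 :> R by rewrite pnatr_eq0 -lt0n fact_gt0.
move: i.+1%:R i`!%:R i0 f0 => u v u0 v0.
by field; rewrite u0 v0.
Qed.

Lemma taylor_term0 s x : taylor_term s 0 x = 1.
Proof. by rewrite /taylor_term expr0 fact0 divr1. Qed.

Lemma taylor_term_ge0 s i x : s <= x -> 0 <= taylor_term s i x.
Proof. by move=> sx; rewrite divr_ge0// exprn_ge0// subr_ge0. Qed.

(** For W_k = (-1)^k w^(k) this is the Taylor polynomial of w with base point [x], cut off below
    degree [i] and evaluated at [s]; the base point is the variable. *)
Definition taylor_sum (W : nat -> R -> R) s i x : R :=
  \sum_(k < i) taylor_term s k x * W k x.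

(* All terms but the last one cancel. *)
Lemma is_derive_taylor_sum W s i x l :
  (forall k, (k < i)%N -> is_derive x 1 (W k) (- W k.+1 x)) ->
  is_derive x 1 (W i) l ->
  is_derive x 1 (taylor_sum W s i.+1) (taylor_term s i x * l).
Proof.
elim: i l => [|i IH] l dW dWi.
  rewrite (_ : taylor_sum _ _ _ = W 0%N).
    by rewrite taylor_term0 mul1r.
  by apply/funext => y; rewrite /taylor_sum big_ord1 taylor_term0 mul1r.
have H := IH _ (fun k ki => dW k (ltnW ki)) (dW i (ltnSn i)).
have E : taylor_sum W s i.+2 = taylor_sum W s i.+1 + taylor_term s i.+1 * W i.+1.
  by apply/funext => y; rewrite /taylor_sum big_ord_recr.
rewrite E; have D := is_derive_taylor_term s i x.
apply: is_derive_eq; rewrite /GRing.scale/=; ring.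
Qed.

Lemma taylor_sum_start W s i : taylor_sum W s i.+1 s = W 0%N s.
Proof.
rewrite /taylor_sum big_ord_recl big1 ?addr0.
  by rewrite taylor_term0 mul1r.
by move=> k _; rewrite /taylor_term subrr expr0n/= !mul0r.
Qed.

Lemma taylor_sum_ge W s i x : s <= x -> (forall k, (k <= i)%N -> 0 <= W k x) ->
  W 0%N x <= taylor_sum W s i.+1 x.
Proof.
move=> sx W0; rewrite /taylor_sum big_ord_recl taylor_term0 mul1r.
by rewrite lerDl sumr_ge0// => k _; rewrite mulr_ge0 ?taylor_term_ge0// W0// ltn_ord.
Qed.

Lemma ac_taylor_sum W s c d i : c <= d ->
  (forall k, (k < i)%N -> abs_continuous_on c d (W k)) ->
  abs_continuous_on c d (taylor_sum W s i).
Proof.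
move=> cd acW.
have : forall k, (k < i)%N -> abs_continuous_on c d (fun x => taylor_term s k x * W k x).
  move=> k ki.
  apply: acM => //; last exact: acW.
  rewrite /taylor_term; apply: acM => //; last exact: ac_cst.
  elim: k {ki} => [|k IH]; first exact: ac_cst.
  rewrite (_ : (fun _ => _) = (fun x => (x - s) * (x - s) ^+ k)); last first.
    by apply/funext => x; rewrite exprS.
  apply: acM => //; apply: (@ac_lipschitz _ _ _ _ 1) => x y _ xy _.
  by rewrite mul1r opprD opprK addrACA addNr addr0 ger0_norm// subr_ge0.
exact: ac_sum.
Qed.

End Derivatives.

(** * The integral inequality on one window *)

Section Window.
Context {R : realType}.

(* The weights [B j * (r - s) ^+ (n - j)] of the Taylor sums are chosen so that
   the derivatives of the lower Taylor sums absorb the terms in [b]. *)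
Lemma window_integral_le (n : nat) (W b : nat -> R -> R) (B : nat -> R)
    (q : R -> R) (gam s r : R) :
  s < r -> 0 <= gam ->
  (forall k, (k <= n)%N -> abs_continuous_on s r (W k)) ->
  (forall k x, (k <= n)%N -> s <= x <= r -> 0 <= W k x) ->
  (forall k x, (k < n)%N -> s < x < r -> is_derive x 1 (W k) (- W k.+1 x)) ->
  {ae leb R, forall x : R, s < x < r -> exists2 l, is_derive x 1 (W n) l &
     l <= - (q x * gam) + \sum_(j < n) b j x * W j.+1 x} ->
  leb_measurable_fun `]s, r[ q -> (forall x, s < x < r -> 0 <= q x) ->
  (forall j, (j < n)%N -> 0 <= B j) ->
  (forall j, (j < n)%N -> {ae leb R, forall x : R, s < x < r -> b j x <= B j}) ->
  (\int[leb R]_(x in `]s, r[) (taylor_term s n x * (q x * gam))%:E <=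
    ((1 + \sum_(j < n) B j * (r - s) ^+ (n - j)) * (W 0%N s - W 0%N r))%:E)%E.
Proof.
move=> sr gam0 acW W0 dW aeW mq q0 B0 aeB.
pose c j := B j * (r - s) ^+ (n - j).
have c0 j : (j < n)%N -> 0 <= c j.
  by move=> jn; rewrite mulr_ge0 ?B0// exprn_ge0// subr_ge0 ltW.
pose S := taylor_sum W s n.+1 \+ (fun x => \sum_(j < n) c j * taylor_sum W s j.+1 x).
have aeB' : {ae leb R, forall x : R, forall j, (j < n)%N -> s < x < r -> b j x <= B j}.
  apply: leb_ae_forall => j; have [/aeB|jn] := ltnP j n; last exact: leb_aeS aeW.
  exact: leb_aeS.
have H : (\int[leb R]_(x in `]s, r[) (taylor_term s n x * (q x * gam))%:E <=
    (S s - S r)%:E)%E.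
  apply: integral_le_decrease => //.
  - apply: acD; first by apply: ac_taylor_sum => [|k]; [exact: ltW|rewrite ltnS; exact: acW].
    apply: (@ac_sum _ _ _ _ (fun j x => c j * taylor_sum W s j.+1 x)) => j jn.
    apply: acM; [exact: ltW|exact: ac_cst|].
    apply: ac_taylor_sum => [|k]; first exact: ltW.
    by rewrite ltnS => kj; apply: acW; rewrite (leq_trans kj) // ltnW.
  - apply: measurable_funM; last by apply: measurable_funM => //; exact: measurable_cst.
    apply: borel_leb_measurable_fun; first exact: measurable_itv.
    apply: measurable_funM; last exact: measurable_cst.
    apply: measurable_funX; apply: measurable_funB; [exact: measurable_id|exact: measurable_cst].
  - move=> x sxr; apply: mulr_ge0; last by rewrite mulr_ge0 ?q0.
    by apply: taylor_term_ge0; case/andP: sxr => /ltW.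
  apply: leb_aeS (leb_aeI aeW aeB') => x [HW HB] sxr.
  have /andP[/ltW sx /ltW xr] := sxr.
  have [l dWn ln] := HW sxr.
  have D1 := is_derive_taylor_sum s (fun k kn => dW k x kn sxr) dWn.
  have D2 j (jn : (j < n)%N) := is_derive_taylor_sum s
    (fun k kj => dW k x (ltn_trans kj jn) sxr) (dW j x jn sxr).
  have D3 : is_derive x 1 (fun x => \sum_(j < n) c j * taylor_sum W s j.+1 x)
      (\sum_(j < n) c j * (taylor_term s j x * - W j.+1 x)).
    rewrite (_ : (fun _ => _) = \sum_(j < n) (c j *: taylor_sum W s j.+1)); last first.
      by apply/funext => y; rewrite fct_sumE.
    by apply: is_derive_sum => j; apply: is_deriveZ; exact: D2.
  have D := is_deriveD D1 D3.
  apply: slope_le_trans (is_derive_slope_le D).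
  have tn0 := taylor_term_ge0 n sx.
  apply: (@le_trans _ _ (taylor_term s n x * (- (q x * gam) + \sum_(j < n) b j x * W j.+1 x)
     + \sum_(j < n) c j * (taylor_term s j x * - W j.+1 x))).
    by apply: lerD => //; exact: ler_wpM2l.
  (* With t_k for the Taylor terms, what remains is the sum of (t_n b_j - c_j t_j) W_(j+1). Each
     bracket is nonpositive because t_n <= (r - s)^(n-j) t_j and b_j <= B_j. *)
  rewrite mulrDr -addrA mulrN gerDl mulr_sumr -big_split/= sumr_le0// => j _.
  have Wj : 0 <= W j.+1 x by apply: W0; rewrite ?sx.
  rewrite !mulrN !mulrA -mulrBl mulr_le0_ge0// subr_le0.
  have xsj : (x - s) ^+ (n - j) <= (r - s) ^+ (n - j).
    by rewrite lerXn2r ?nnegrE ?subr_ge0// ?lerD2r// (le_trans sx).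
  have xs0 k : 0 <= (x - s) ^+ k by rewrite exprn_ge0// subr_ge0.
  have tj : taylor_term s n x <= (r - s) ^+ (n - j) * taylor_term s j x.
    rewrite /taylor_term -{1}(subnK (ltnW (ltn_ord j))) exprD -mulrA.
    apply: ler_pM => //; first by rewrite mulr_ge0// invr_ge0.
    apply: ler_wpM2l => //; rewrite lef_pV2 ?posrE ?ltr0n ?fact_gt0//.
    by rewrite ler_nat leq_fact// ltnW.
  apply: (@le_trans _ _ (taylor_term s n x * B j)); first by apply: ler_wpM2l => //; exact: HB.
  have -> : c j * (x - s) ^+ j / j`!%:R = B j * ((r - s) ^+ (n - j) * taylor_term s j x).
    by rewrite /c /taylor_term !mulrA.
  by rewrite mulrC; apply: ler_wpM2l => //; exact: B0.
apply: (le_trans H); rewrite lee_fin.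
(* Every Taylor sum equals [W 0%N s] at [s] and is at least [W 0%N r] at [r], so [S] decreases by at
   most its total weight times the decrease of [W 0%N]. *)
have -> : S s = (1 + \sum_(j < n) c j) * W 0%N s.
  rewrite /S/= taylor_sum_start mulrDl mul1r; congr (_ + _).
  by rewrite mulr_suml; apply: eq_bigr => j _; rewrite taylor_sum_start.
rewrite mulrBr lerB// mulrDl mul1r /S/= lerD//.
  by apply: taylor_sum_ge => [|k kn]; [exact: ltW|apply: W0; rewrite ?lexx ?ltW].
rewrite mulr_suml; apply: ler_sum => j _; apply: ler_wpM2l; first exact: c0.
apply: taylor_sum_ge => [|k kj]; first exact: ltW.
by apply: W0; rewrite ?lexx ?(ltW sr)// (leq_trans kj)// ltnW.
Qed.

End Window.

(** * Integrals over half-open intervals, which split without overlap *)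

Section IntervalIntegrals.
Context {R : realType}.
Implicit Types (phi psi nu : R -> R) (s x y r : R).

Lemma leb_integral_split phi s x r : s <= x -> x <= r ->
  leb_measurable_fun `]s, r] phi -> (forall y, s < y <= r -> 0 <= phi y) ->
  (\int[leb R]_(y in `]s, r]) (phi y)%:E = \int[leb R]_(y in `]s, x]) (phi y)%:E
    + \int[leb R]_(y in `]x, r]) (phi y)%:E)%E.
Proof.
move=> sx xr mphi phi0.
have E : `]s, r]%classic = `]s, x]%classic `|` `]x, r]%classic.
  apply/seteqP; split => y /=; rewrite !in_itv/=.
    by move=> /andP[sy yr]; have [yx|xy] := leP y x; [left|right]; rewrite ?sy ?yr.
  by move=> [/andP[-> /le_trans ->]//|/andP[xy ->]]; rewrite (le_lt_trans sx xy).
rewrite E; apply: ge0_integral_setU.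
- exact: leb_measurable_itv.
- exact: leb_measurable_itv.
- by rewrite -E; exact/measurable_EFinP.
- by rewrite -E => y; rewrite /= in_itv/= lee_fin; exact: phi0.
- apply/disj_setPS => y []; rewrite /= !in_itv/= => /andP[_ yx] /andP[xy _].
  by have := lt_le_trans xy yx; rewrite ltxx.
Qed.

Lemma leb_integral_oo_oc phi s r : leb_measurable_fun `]s, r] phi ->
  (forall y, s < y <= r -> 0 <= phi y) ->
  (\int[leb R]_(y in `]s, r]) (phi y)%:E = \int[leb R]_(y in `]s, r[) (phi y)%:E)%E.
Proof.
move=> mphi phi0.
rewrite (@ge0_negligible_integral _ _ _ _ _ (`[r, r]%classic : set (lebR R))).
- congr integral; apply/seteqP; split => y; rewrite /= !in_itv/=.
    move=> [/andP[-> yr]] yNr; rewrite lt_neqAle yr andbT; apply/eqP => yr'.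
    by apply: yNr; rewrite yr' lexx.
  move=> /andP[-> yr]; split; first exact: ltW.
  by rewrite leNgt yr.
- exact: leb_measurable_itv.
- exact: leb_measurable_itv.
- exact/measurable_EFinP.
- by move=> y; rewrite /= in_itv/= lee_fin; exact: phi0.
- by have := leb_itv_bnd true false (lexx r); rewrite subrr.
Qed.

Lemma leb_integral_le phi psi s r : leb_measurable_fun `]s, r] phi ->
  leb_measurable_fun `]s, r] psi -> (forall y, s < y <= r -> 0 <= phi y) ->
  (forall y, s < y <= r -> 0 <= psi y) ->
  {ae leb R, forall y : R, s < y < r -> phi y <= psi y} ->
  (\int[leb R]_(y in `]s, r]) (phi y)%:E <= \int[leb R]_(y in `]s, r]) (psi y)%:E)%E.
Proof.
move=> mphi mpsi phi0 psi0 ae; apply: ae_ge0_le_integral.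
- exact: leb_measurable_itv.
- by move=> y; rewrite /= in_itv/= lee_fin; exact: phi0.
- exact/measurable_EFinP.
- by move=> y; rewrite /= in_itv/= lee_fin; exact: psi0.
- exact/measurable_EFinP.
have aer : {ae leb R, forall y : R, y <> r}.
  by apply: negligibleS (leb_negligible1 r) => y /= /contrapT.
apply: leb_aeS (leb_aeI ae aer) => y [H yr]; rewrite /= in_itv/= lee_fin => /andP[sy yr'].
by apply: H; rewrite sy lt_neqAle yr' andbT; exact/eqP.
Qed.

Lemma leb_integral_cst (k : R) s r : s <= r ->
  (\int[leb R]_(y in `]s, r]) k%:E = (k * (r - s))%:E)%E.
Proof.
move=> sr; rewrite integral_cst; last exact: leb_measurable_itv.
by have := leb_itv_bnd false false sr => /= ->; rewrite -EFinM.
Qed.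

Lemma leb_integral_ge0 phi s r : (forall y, s < y <= r -> 0 <= phi y) ->
  (0 <= \int[leb R]_(y in `]s, r]) (phi y)%:E)%E.
Proof.
by move=> phi0; apply: integral_ge0 => y; rewrite /= in_itv/= lee_fin; exact: phi0.
Qed.

Lemma leb_integral_fin_num phi (K : R) s r : s <= r ->
  leb_measurable_fun `]s, r] phi -> (forall y, s < y <= r -> 0 <= phi y) ->
  {ae leb R, forall y : R, s < y < r -> phi y <= K} ->
  (\int[leb R]_(y in `]s, r]) (phi y)%:E <= (`|K| * (r - s))%:E)%E /\
  (\int[leb R]_(y in `]s, r]) (phi y)%:E)%E \is a fin_num.
Proof.
move=> sr mphi phi0 aeK.
have le : (\int[leb R]_(y in `]s, r]) (phi y)%:E <= (`|K| * (r - s))%:E)%E.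
  rewrite -leb_integral_cst//; apply: leb_integral_le => //.
    exact: measurable_cst.
  by apply: leb_aeS aeK => y H /H /le_trans; apply; exact: ler_norm.
by split => //; rewrite ge0_fin_numE ?leb_integral_ge0// (le_lt_trans le)// ltry.
Qed.

(** The bound [K] makes the primitive of [phi] Lipschitz, so the intermediate value theorem applies
    to it. *)
Lemma leb_integral_median phi (K A : R) s r : s <= r ->
  leb_measurable_fun `]s, r] phi -> (forall y, s < y <= r -> 0 <= phi y) ->
  (forall y, s < y <= r -> phi y <= K) ->
  (\int[leb R]_(y in `]s, r]) (phi y)%:E = A%:E)%E ->
  exists x, [/\ s <= x <= r,
    (\int[leb R]_(y in `]s, x]) (phi y)%:E = (A / 2)%:E)%E &
    (\int[leb R]_(y in `]x, r]) (phi y)%:E = (A / 2)%:E)%E].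
Proof.
move=> sr mphi phi0 phiK intA.
have sub x y : s <= x -> y <= r -> `]x, y]%classic `<=` (`]s, r]%classic : set R).
  move=> sx yr z; rewrite /= !in_itv/= => /andP[xz zy].
  by rewrite (le_lt_trans sx xz) (le_trans zy yr).
have mS x y : s <= x -> y <= r -> leb_measurable_fun `]x, y] phi.
  move=> sx yr; apply: measurable_funS mphi; first exact: leb_measurable_itv.
  exact: sub.
have phiS x y : s <= x -> y <= r -> forall z, x < z <= y -> 0 <= phi z <= K.
  move=> sx yr z /andP[xz zy].
  have szr : s < z <= r by rewrite (le_lt_trans sx xz) (le_trans zy yr).
  by rewrite phi0 ?phiK.
have bnd x y : s <= x -> x <= y -> y <= r ->
    (\int[leb R]_(z in `]x, y]) (phi z)%:E <= (`|K| * (y - x))%:E)%E /\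
    (\int[leb R]_(z in `]x, y]) (phi z)%:E)%E \is a fin_num.
  move=> sx xy yr; apply: leb_integral_fin_num => //; first exact: mS.
    by move=> z /(phiS x y sx yr)/andP[].
  apply: leb_aeW => z /andP[xz /ltW zy].
  have xzy : x < z <= y by rewrite xz.
  by have /andP[] := phiS x y sx yr z xzy.
pose I x := fine (\int[leb R]_(z in `]s, x]) (phi z)%:E)%E.
have splitI x y : s <= x -> x <= y -> y <= r ->
    I y = I x + fine (\int[leb R]_(z in `]x, y]) (phi z)%:E)%E.
  move=> sx xy yr; have sy := le_trans sx xy; have xr := le_trans xy yr.
  rewrite /I -fineD; last first.
  - by have [] := bnd _ _ sx xy yr.
  - by have [] := bnd _ _ (lexx s) sx xr.
  congr fine; apply: leb_integral_split => //; first exact: mS.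
  by move=> z /(phiS s y (lexx s) yr)/andP[].
have cI : {within `[s, r], continuous I}.
  apply: ac_continuous; apply: (@ac_lipschitz _ _ _ _ `|K|) => x y sx xy yr.
  rewrite (splitI x y)// addrC addKr.
  have [le fin] := bnd x y sx xy yr.
  rewrite ger0_norm; first by rewrite -lee_fin fineK.
  by apply: fine_ge0; apply: leb_integral_ge0 => z Hz; have /andP[] := phiS x y sx yr z Hz.
have Is : I s = 0.
  by rewrite /I set_itvoc0 integral_set0.
have Ir : I r = A by rewrite /I intA.
have A0 : 0 <= A by rewrite -lee_fin -intA leb_integral_ge0.
have [|x] := IVT sr cI (v := A / 2).
  rewrite Is Ir ge_min le_max divr_ge0//=; apply/orP; right.
  by rewrite ler_pdivrMr// mulr_natr mulr2n lerDl.
rewrite in_itv/= => sxr Ix; have /andP[sx xr] := sxr.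
have I1 : (\int[leb R]_(y in `]s, x]) (phi y)%:E = (A / 2)%:E)%E.
  by rewrite -Ix fineK//; have [] := bnd s x (lexx s) sx xr.
exists x; split => //.
have [_ fin] := bnd x r sx xr (lexx r).
have := splitI x r sx xr (lexx r); rewrite Ir Ix -(fineK fin) => H.
by congr EFin; lra.
Qed.

(* Up to the median x of phi the bound [phi <= nu x] applies, beyond it the
   bound [phi * nu x ^+ n <= psi]; multiplying them eliminates nu. *)
Lemma median_le_moment n phi psi nu (K A F : R) s r : s <= r ->
  leb_measurable_fun `]s, r] phi -> (forall y, s < y <= r -> 0 <= phi y) ->
  (forall y, s < y <= r -> phi y <= K) ->
  leb_measurable_fun `]s, r] psi -> (forall y, s < y <= r -> 0 <= psi y) ->
  (forall x, s < x <= r -> 0 <= nu x) ->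
  (forall x y, s < x -> x <= y -> y <= r -> nu x <= nu y) ->
  {ae leb R, forall x : R, s < x < r -> phi x * nu x ^+ n <= psi x /\ phi x <= nu x} ->
  (\int[leb R]_(x in `]s, r]) (phi x)%:E = A%:E)%E ->
  (\int[leb R]_(x in `]s, r]) ((x - s) ^+ n * psi x)%:E <= F%:E)%E ->
  (A / 2) ^+ n.+1 <= F.
Proof.
move=> sr mphi phi0 phiK mpsi psi0 nu0 nu_nd ae intA intF.
have xsn x k : s <= x -> 0 <= (x - s) ^+ k by move=> sx; rewrite exprn_ge0// subr_ge0.
have mxs (D : set R) : measurable D -> leb_measurable_fun D (fun x => (x - s) ^+ n).
  move=> mD; apply: borel_leb_measurable_fun => //; apply: measurable_funX.
  by apply: measurable_funB; [exact: measurable_id|exact: measurable_cst].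
have F0 : 0 <= F.
  rewrite -lee_fin (le_trans _ intF)// leb_integral_ge0// => y /andP[sy yr].
  by rewrite mulr_ge0 ?xsn ?psi0 ?sy// ltW.
have A0 : 0 <= A by rewrite -lee_fin -intA leb_integral_ge0.
have [x [/andP[sx xr] I1 I2]] := leb_integral_median sr mphi phi0 phiK intA.
(* For [A = 0] the median could be [s] itself, where nothing is known about [nu]. *)
have [A0'|] := eqVneq A 0; first by rewrite A0' mul0r expr0n.
move=> An0; have Agt0 : 0 < A by rewrite lt_neqAle eq_sym An0.
have sx' : s < x.
  rewrite lt_neqAle sx andbT; apply/eqP => E; move: I1.
  rewrite E set_itvoc0 integral_set0 => -[] /esym/eqP.
  by rewrite mulf_eq0 (negbTE An0) invr_eq0 pnatr_eq0.
have nux : 0 <= nu x by rewrite nu0// sx'.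
have H1 : A / 2 <= nu x * (x - s).
  rewrite -lee_fin -I1 -leb_integral_cst//; apply: leb_integral_le => //.
  - apply: measurable_funS mphi; first exact: leb_measurable_itv.
    by move=> z; rewrite /= !in_itv/= => /andP[-> /le_trans]; apply.
  - exact: measurable_cst.
  - by move=> y /andP[sy yx]; rewrite phi0// sy (le_trans yx).
  apply: leb_aeS ae => y H /andP[sy yx].
  have [|_ yn] := H; first by rewrite sy (lt_le_trans yx).
  by rewrite (le_trans yn)// nu_nd// ltW.
have H2 : (x - s) ^+ n * nu x ^+ n * (A / 2) <= F.
  have c0 : 0 <= (x - s) ^+ n * nu x ^+ n by rewrite mulr_ge0 ?xsn// exprn_ge0.
  have mphix : leb_measurable_fun `]x, r] phi.
    apply: measurable_funS mphi; first exact: leb_measurable_itv.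
    by move=> z; rewrite /= !in_itv/= => /andP[/(lt_trans sx') -> ->].
  have phix0 z : x < z <= r -> 0 <= phi z.
    by move=> /andP[xz zr]; rewrite phi0// (lt_trans sx').
  have mm : leb_measurable_fun `]s, r] (fun x => (x - s) ^+ n * psi x).
    by apply: measurable_funM; [apply: mxs; exact: measurable_itv|exact: mpsi].
  rewrite -lee_fin EFinM -I2 -ge0_integralZl_EFin; last 4 first.
  - exact: leb_measurable_itv.
  - by move=> z; rewrite /= in_itv/= lee_fin; exact: phix0.
  - exact/measurable_EFinP.
  - exact: c0.
  apply: le_trans intF; rewrite [leRHS](leb_integral_split sx xr)//; last first.
    by move=> y /andP[sy yr]; rewrite mulr_ge0 ?xsn ?psi0 ?sy// ltW.
  rewrite -[leLHS]add0e; apply: leeD.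
    apply: leb_integral_ge0 => y /andP[sy yx].
    by rewrite mulr_ge0 ?xsn ?psi0 ?sy ?(le_trans yx)// ltW.
  under eq_integral do rewrite -EFinM.
  apply: leb_integral_le => //.
  - by apply: measurable_funM => //; exact: measurable_cst.
  - apply: measurable_funS mm; first exact: leb_measurable_itv.
    by move=> z; rewrite /= !in_itv/= => /andP[/(lt_trans sx') -> ->].
  - by move=> y xyr; rewrite mulr_ge0// phix0.
  - move=> y /andP[xy yr]; have sy := lt_trans sx' xy.
    by rewrite mulr_ge0 ?xsn ?psi0 ?sy// ltW.
  apply: leb_aeS ae => y H /andP[xy yr]; have sy := lt_trans sx' xy.
  have [|yn _] := H; first by rewrite sy.
  rewrite -mulrA ler_pM ?xsn//.
  - by rewrite mulr_ge0 ?exprn_ge0// phix0// xy ltW.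
  - by rewrite lerXn2r ?nnegrE ?subr_ge0 ?lerD2r// ltW.
  have phiy : 0 <= phi y by apply: phix0; rewrite xy ltW.
  have nuy : nu x <= nu y by apply: nu_nd => //; exact: ltW.
  apply: le_trans yn; rewrite mulrC; apply: ler_wpM2l => //.
  by apply: lerXn2r; rewrite ?nnegrE// (le_trans nux).
apply: le_trans H2; rewrite exprSr ler_wpM2r ?divr_ge0//.
rewrite -exprMn [_ * nu x]mulrC; apply: lerXn2r => //; rewrite nnegrE ?divr_ge0//.
by rewrite mulr_ge0// subr_ge0.
Qed.

End IntervalIntegrals.

(** * Essential suprema with real values *)

Section EssentialSupremum.
Context {R : realType}.
Implicit Types (D : set R) (f : R -> R) (M s r x : R).

Local Notation esup D f :=
  (ess_sup (leb R) (patch (fun=> -oo%E) D (fun x => (f x)%:E))).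

Lemma leb_ae_forall_count (T : countType) (P : T -> R -> Prop) :
  (forall i, {ae leb R, forall x : R, P i x}) ->
  {ae leb R, forall x : R, forall i, P i x}.
Proof.
move=> aeP; pose P' k x := if unpickle k is Some i then P i x else True.
have : {ae leb R, forall x : R, forall k, P' k x}.
  apply: leb_ae_forall => k; rewrite /P'; case: unpickle => [i|]; first exact: aeP.
  exact: leb_aeW.
by apply: leb_aeS => x H i; have := H (pickle i); rewrite /P' pickleK.
Qed.

Lemma esup_le D f M : {ae leb R, forall x : R, D x -> f x <= M} ->
  (esup D f <= M%:E)%E.
Proof.
move=> ae; apply/ess_supP; apply: leb_aeS ae => x H.
by rewrite /patch; case: ifPn => [/set_mem/H|_]; rewrite ?lee_fin// leNye.
Qed.

Lemma esup_ge D f : {ae leb R, forall x : R, D x -> ((f x)%:E <= esup D f)%E}.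
Proof.
apply: leb_aeS (ess_sup_ge (leb R) (patch (fun=> -oo%E) D (fun x => (f x)%:E))) => x.
by move=> H Dx; move: H; rewrite /patch mem_set.
Qed.

(** The bound [M] excludes the value [+oo], which [fine] would turn into 0. *)
Lemma ess_sup_on_ae_ge D f M : {ae leb R, forall x : R, D x -> f x <= M} ->
  {ae leb R, forall x : R, D x -> f x <= ess_sup_on D f}.
Proof.
move=> /esup_le le; apply: leb_aeS (esup_ge D f) => x H Dx; move: (H Dx) le.
by rewrite /ess_sup_on; case: ess_sup => [l| |]; rewrite ?lee_fin ?leye_eq ?leeNy_eq.
Qed.

(** [0 <= M] accounts for a null set [D], where the extended supremum is [-oo] and [fine] gives
    0. *)
Lemma ess_sup_on_le D f M : 0 <= M -> {ae leb R, forall x : R, D x -> f x <= M} ->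
  ess_sup_on D f <= M.
Proof.
move=> M0 /esup_le; rewrite /ess_sup_on; case: ess_sup => [l| |] //=.
Qed.

Lemma ess_sup_on_ge0 D f : (forall x, D x -> 0 <= f x) -> 0 <= ess_sup_on D f.
Proof.
move=> f0; have [l0|l0] := leP 0%E (esup D f); first exact: fine_ge0.
have -> : ess_sup_on D f = 0; last by [].
rewrite /ess_sup_on (_ : esup D f = -oo%E)//.
apply/eqP; rewrite -leeNy_eq; apply/ess_supP; apply: leb_aeS (esup_ge D f) => x H.
rewrite /patch; case: ifPn => [/set_mem Dx|//].
by have := le_lt_trans (H Dx) l0; rewrite lte_fin ltNge f0.
Qed.

Lemma le_ess_sup_on D D' f M : D `<=` D' -> (forall x, D' x -> 0 <= f x) ->
  {ae leb R, forall x : R, D' x -> f x <= M} ->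
  ess_sup_on D f <= ess_sup_on D' f.
Proof.
move=> DD' f0 aeM; apply: ess_sup_on_le; first exact: ess_sup_on_ge0.
by apply: leb_aeS (ess_sup_on_ae_ge aeM) => x H /DD'.
Qed.

(* A failure [f x > N x] at a point x that is not the largest such point for a
   rational level p lies in the null set where [f > p] left of a rational. *)
Lemma ess_sup_on_left_ae_ge f M s r :
  {ae leb R, forall x : R, s < x < r -> f x <= M} ->
  {ae leb R, forall x : R, s < x < r -> f x <= ess_sup_on `]s, x[ f}.
Proof.
move=> aeM; pose N x := ess_sup_on `]s, x[ f.
pose E (p : rat) x := s < x < r /\ N x < ratr p < f x.
have ae1 : {ae leb R, forall y : R, forall pq : rat * rat,
    (exists2 x, E pq.1 x & ratr pq.2 < x) -> s < y < ratr pq.2 -> f y <= ratr pq.1}.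
  apply: leb_ae_forall_count => -[p q] /=.
  have [[x [/andP[sx xr] /andP[Np _]] qx]|nE] := pselect (exists2 x, E p x & ratr q < x);
    last by apply: leb_aeW.
  have : {ae leb R, forall y : R, `]s, x[%classic y -> f y <= N x}.
    apply: (@ess_sup_on_ae_ge _ _ M); apply: leb_aeS aeM => y H.
    by rewrite /= in_itv/= => /andP[sy yx]; apply: H; rewrite sy (lt_trans yx).
  apply: leb_aeS => y H _ /andP[sy yq]; rewrite (le_trans (H _)) ?(ltW Np)//.
  by rewrite /= in_itv/= sy (lt_trans yq).
have ae2 : {ae leb R, forall y : R, forall p : rat, E p y -> exists2 x, E p x & y < x}.
  apply: leb_ae_forall_count => p.
  have [[x Ex maxx]|nmax] := pselect (exists2 x, E p x & forall y, E p y -> y <= x).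
    apply: negligibleS (leb_negligible1 x) => y /= /not_implyP[Ey ny].
    apply/eqP; rewrite eq_le maxx//= leNgt; apply/negP => yx.
    by apply: ny; exists x.
  apply: leb_aeW => y Ey; apply: contrapT => ny; apply: nmax; exists y => // z Ez.
  by rewrite leNgt; apply/negP => yz; apply: ny; exists z.
apply: leb_aeS (leb_aeI ae1 ae2) => y [H1 H2] syr.
rewrite leNgt; apply/negP => Nf; have [p] := rat_in_itvoo Nf.
rewrite in_itv/= => pI; have [x Ex yx] := H2 p (conj syr pI).
have [q] := rat_in_itvoo yx; rewrite in_itv/= => /andP[yq qx].
have : f y <= ratr p.
  by apply: (H1 (p, q)) => /=; [exists x|case/andP: syr => -> _].
by case/andP: pI => _; rewrite leNgt => ->.
Qed.

End EssentialSupremum.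

(** * Roots and the weight of the divergent integral *)

Section Roots.
Context {R : realType}.
Variable n : nat.
Implicit Types (x y f N mu : R).

Local Notation root y := (y `^ n.+1%:R^-1).

Lemma rootXn y : 0 <= y -> root y ^+ n.+1 = y.
Proof.
by move=> y0; rewrite -powR_mulrn ?powR_ge0// -powRrM mulVf ?powRr1// pnatr_eq0.
Qed.

Lemma powR_invn_sub1 y : 0 < y -> y `^ (n.+1%:R^-1 - 1) = (root y ^+ n)^-1.
Proof.
move=> y0; rewrite powRD; last by apply/implyP => _; rewrite gt_eqF.
have r0 : 0 < root y by rewrite powR_gt0.
rewrite powR_inv1 ?ltW// -{2}(rootXn (ltW y0)) exprS invfM mulrA mulfV ?mul1r//.
by rewrite gt_eqF.
Qed.

(* With [nu] the root of [N], the weight of the divergent integral satisfies the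
   two hypotheses of [median_le_moment]. *)
Lemma weight_bounds x f N mu : 0 < x -> 0 <= f -> 0 <= N -> 1 + x ^+ n.+1 * N <= mu ->
  x ^+ n * f * mu `^ (n.+1%:R^-1 - 1) * root N ^+ n <= f /\
  (f <= N -> x ^+ n * f * mu `^ (n.+1%:R^-1 - 1) <= root N).
Proof.
move=> x0 f0 N0 Nmu.
have xN0 : 0 <= x ^+ n.+1 * N by rewrite mulr_ge0// exprn_ge0// ltW.
have mu0 : 0 < mu by lra.
have l0 : 0 < root mu by rewrite powR_gt0.
have nu0 : 0 <= root N by rewrite powR_ge0.
have xnu : x * root N <= root mu.
  rewrite -(@ler_pXn2r _ n.+1)// ?nnegrE ?mulr_ge0// ?(ltW x0)// ?(ltW l0)//.
  by rewrite exprMn !rootXn// ?(ltW mu0)//; lra.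
(* Call this ratio t. The first product equals f t^n, and after [f <= N] the second is at most
   [root N] times t^n, so both claims reduce to t <= 1. *)
have t0 : 0 <= x * root N / root mu by rewrite divr_ge0 ?mulr_ge0 ?(ltW x0) ?(ltW l0).
have t1 : x * root N / root mu <= 1 by rewrite ler_pdivrMr// mul1r.
have tn : (x * root N / root mu) ^+ n <= 1 by rewrite exprn_ile1.
rewrite powR_invn_sub1//; split.
  rewrite (_ : _ * _ * _ * _ = f * (x * root N / root mu) ^+ n).
    by rewrite -[leRHS]mulr1; apply: ler_wpM2l.
  by rewrite !exprMn exprVn; ring.
move=> fN; rewrite (_ : _ * _ * _ = f * (x / root mu) ^+ n); last first.
  by rewrite exprMn exprVn; ring.
apply: (@le_trans _ _ (N * (x / root mu) ^+ n)).
  by apply: ler_wpM2r => //; rewrite exprn_ge0// divr_ge0// ltW.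
have -> : N * (x / root mu) ^+ n = root N * (x * root N / root mu) ^+ n.
  by rewrite -[X in X * _ = _](rootXn N0) exprS !exprMn; ring.
by rewrite -[leRHS]mulr1; apply: ler_wpM2l.
Qed.

Lemma weight_le x f mu : 0 <= x -> 0 <= f -> 1 <= mu ->
  0 <= x ^+ n * f * mu `^ (n.+1%:R^-1 - 1) <= x ^+ n * f.
Proof.
move=> x0 f0 mu1; have xf : 0 <= x ^+ n * f by rewrite mulr_ge0// exprn_ge0.
rewrite mulr_ge0 ?powR_ge0//= -[leRHS]mulr1; apply: ler_wpM2l => //.
rewrite powR_invn_sub1 ?(lt_le_trans ltr01)//.
have l1 : 1 <= root mu ^+ n.
  rewrite exprn_ege1// -(@ler_pXn2r _ n.+1)// ?nnegrE ?powR_ge0//.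
  by rewrite expr1n rootXn// (le_trans ler01).
by rewrite invf_le1// (lt_le_trans ltr01).
Qed.

End Roots.

(** * Estimates for a positive solution on one window, with m = n + 1 *)

Section SolutionWindow.
Context {R : realType}.
Variables (n : nat) (a : R) (Q : R -> 'rV[R]_n.+1 -> R) (q : R -> R).
Variables (b : nat -> R -> R) (h w : R -> R).
Hypothesis q_ge0 : forall r, a <= r -> 0 <= q r.
Hypothesis q_Linfty : Linfty_loc a q.
Hypothesis b_ge0 : forall i r, (1 <= i < n.+1)%N -> a <= r -> 0 <= b i r.
Hypothesis b_Linfty : forall i, (1 <= i < n.+1)%N -> Linfty_loc a (b i).
Hypothesis Q_ge : forall (r : R) (t : nat -> R), a <= r -> 0 < t 0%N ->
  (forall i, (1 <= i < n.+1)%N -> 0 <= (-1) ^+ i * t i) ->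
  (-1) ^+ n.+1 * Q r (\row_(i < n.+1) t i) >=
    q r * h (t 0%N) - \sum_(1 <= i < n.+1) b i r * `|t i|.
Hypothesis w_sol : is_solution a Q w.
Hypothesis w_gt0 : forall r, a <= r -> 0 < w r.

Let W k x := (-1) ^+ k * derivn_from a k w x.

Lemma solution_window_le (B : nat -> R) (gam s r : R) : a <= s -> s < r -> 0 <= gam ->
  (forall x, s <= x <= r -> gam <= h (w x)) ->
  (forall j, (j < n)%N -> 0 <= B j) ->
  (forall j, (j < n)%N -> {ae leb R, forall x : R, s < x < r -> b j.+1 x <= B j}) ->
  (\int[leb R]_(x in `]s, r[) (taylor_term s n x * (q x * gam))%:E <=
    ((1 + \sum_(j < n) B j * (r - s) ^+ (n - j)) * (w s - w r))%:E)%E.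
Proof.
move=> as_ sr gam0 gamh B0 aeB; have [dw acw eqw sgw] := w_sol.
have asr x : s < x < r -> a < x by move=> /andP[sx _]; exact: le_lt_trans sx.
have -> : w s - w r = W 0%N s - W 0%N r by rewrite /W expr0 !mul1r.
apply: (@window_integral_le _ _ W (fun j => b j.+1)) => //.
- move=> k kn; apply: acM; [exact: ltW|exact: ac_cst|].
  by apply: acw => //; exact: ltW.
- by move=> k x kn /andP[sx _]; apply: sgw => //; exact: le_trans sx.
- move=> k x kn sxr; have ax := asr _ sxr.
  have D := derivable_from_is_derive ax (dw k x kn (ltW ax)).
  have := is_deriveZ ((-1) ^+ k) D.
  rewrite (_ : _ *: deriv_from a (derivn_from a k w) x = - W k.+1 x)//.
  by rewrite /W exprS mulN1r mulNr opprK.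
- apply: leb_aeS eqw => x H sxr; have ax := asr _ sxr.
  have [dWn E] := H (ltW ax).
  (* This is -(-1)^m w^(m), so the lower bound on (-1)^m Q becomes the required upper bound. *)
  exists ((-1) ^+ n * derivn_from a n.+1 w x).
    by have := is_deriveZ ((-1) ^+ n) (derivable_from_is_derive ax dWn).
  have := @Q_ge x (fun i => derivn_from a i w x) (ltW ax) (w_gt0 (ltW ax)).
  have W0 i : (i < n.+1)%N -> 0 <= (-1) ^+ i * derivn_from a i w x.
    by move=> ni; apply: sgw => //; exact: ltW.
  move=> HQ; have {HQ} := HQ (fun i ni => W0 i (proj2 (andP ni))).
  rewrite -E big_add1/= big_mkord.
  have -> : \sum_(j < n) b j.+1 x * `|derivn_from a j.+1 w x| =
           \sum_(j < n) b j.+1 x * W j.+1 x.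
    apply: eq_bigr => j _; congr (_ * _).
    have := W0 j.+1 (ltn_ord (lift ord0 j)); rewrite /W => /ger0_norm <-.
    by rewrite normrM normrX normrN1 expr1n mul1r.
  rewrite exprS mulN1r mulNr => HQ.
  have gx : gam <= h (w x).
    by case/andP: sxr => /ltW sx /ltW xr; apply: gamh; rewrite sx.
  have qg : q x * gam <= q x * h (w x) by apply: ler_wpM2l => //; exact: q_ge0 (ltW ax).
  lra.
- apply: measurable_funS (proj1 q_Linfty); first exact: leb_measurable_itv.
  by move=> x; rewrite /= !in_itv/= andbT => /asr/ltW.
- by move=> x /asr/ltW; exact: q_ge0.
Qed.

Variable sigma : R.
Hypotheses (a_gt0 : 0 < a) (sigma_gt1 : 1 < sigma).

Local Notation f := (f_fun n.+1 a sigma q b).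
Local Notation mu := (mu_fun n.+1 a sigma q b).
Local Notation weight x := (x ^+ n * f x * mu x `^ (n.+1%:R^-1 - 1)).

Let sigma_gt0 : 0 < sigma. Proof. exact: lt_trans sigma_gt1. Qed.

Let denom x := 1 + \sum_(1 <= i < n.+1)
  x ^+ (n.+1 - i) * ess_sup_on (`]x / sigma, x * sigma[ `&` `[a, +oo[) (b i).

Let denom_ge1 x : a <= x -> 1 <= denom x.
Proof.
move=> ax; rewrite /denom lerDl big_nat_cond; apply: sumr_ge0 => i /andP[i1n _].
apply: mulr_ge0; first by rewrite exprn_ge0// (le_trans (ltW a_gt0)).
apply: ess_sup_on_ge0 => y [_]; rewrite /= in_itv/= andbT; exact: b_ge0.
Qed.

Lemma f_fun_ge0 x : a <= x -> 0 <= f x.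
Proof.
move=> ax; rewrite /f_fun divr_ge0 ?q_ge0//.
by rewrite (le_trans ler01)//; exact: denom_ge1.
Qed.

Lemma f_fun_le x : a <= x -> f x <= q x.
Proof.
move=> ax; have d1 := denom_ge1 ax.
rewrite /f_fun ler_pdivrMr; last exact: lt_le_trans d1.
by rewrite -[leLHS]mulr1; apply: ler_wpM2l; rewrite ?q_ge0.
Qed.

Lemma f_fun_ae_le c d : a <= c -> c <= d ->
  exists M, {ae leb R, forall x : R, c <= x <= d -> f x <= M}.
Proof.
move=> ac cd; have [_ /(_ c d ac cd)[M aeM]] := q_Linfty.
exists M; apply: leb_aeS aeM => x H cxd; have /andP[cx _] := cxd.
by rewrite (le_trans (f_fun_le (le_trans ac cx)))// (le_trans (ler_norm _))// H.
Qed.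

Lemma mu_fun_ge x N : a <= x -> N <= ess_sup_on (`]x / sigma, x[ `&` `[a, +oo[) f ->
  1 + x ^+ n.+1 * N <= mu x.
Proof.
move=> ax HN; rewrite /mu_fun lerD2l; apply: ler_wpM2l => //.
by rewrite exprn_ge0// (le_trans (ltW a_gt0)).
Qed.

Lemma mu_fun_ge1 x : a <= x -> 1 <= mu x.
Proof.
move=> ax; have := @mu_fun_ge x 0 ax; rewrite mulr0 addr0; apply.
apply: ess_sup_on_ge0 => y [_]; rewrite /= in_itv/= andbT; exact: f_fun_ge0.
Qed.

Lemma weight_le_q x : a <= x -> 0 <= weight x <= x ^+ n * q x.
Proof.
move=> ax; have x0 : 0 <= x := le_trans (ltW a_gt0) ax.
have /andP[-> /le_trans] := weight_le n x0 (f_fun_ge0 ax) (mu_fun_ge1 ax).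
by apply; apply: ler_wpM2l; [exact: exprn_ge0|exact: f_fun_le].
Qed.

Section Estimates.
Variables (s r gam : R).
Hypotheses (as_ : a <= s) (sr : s < r) (rsigma : r <= sigma * s) (r2 : r <= 2 * s).
Hypotheses (gam_gt0 : 0 < gam) (gam_h : forall x, s <= x <= r -> gam <= h (w x)).

Let B j := ess_sup_on `]s, r[ (b j.+1).
Let D := 1 + \sum_(j < n) B j * (r - s) ^+ (n - j).
Let psi x := q x / D.

Let itv_ge x : s < x -> a <= x. Proof. by move=> sx; rewrite (le_trans as_)// ltW. Qed.

Let B_ge0 j : (j < n)%N -> 0 <= B j.
Proof.
move=> jn; apply: ess_sup_on_ge0 => x; rewrite /= in_itv/= => /andP[/itv_ge ax _].
exact: b_ge0.
Qed.

Let D_ge1 : 1 <= D.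
Proof.
rewrite lerDl; apply: sumr_ge0 => j _; rewrite mulr_ge0 ?B_ge0// exprn_ge0//.
by rewrite subr_ge0 ltW.
Qed.

Let D_gt0 : 0 < D. Proof. exact: lt_le_trans D_ge1. Qed.

(** The size of the window enters here: [r <= 2 * s] gives r - s <= x, and [r <= sigma * s] puts
    []s, r[] inside the interval around [x] used by [f_fun], so [D] is at most the denominator at
    [x]. *)
Let f_fun_le_psi x : s < x <= r -> f x <= psi x.
Proof.
move=> /andP[sx xr]; have ax := itv_ge sx.
rewrite /f_fun /psi; apply: ler_wpM2l; first exact: q_ge0.
rewrite lef_pV2 ?posrE//; last by rewrite (lt_le_trans ltr01)//; exact: denom_ge1.
rewrite lerD2l big_add1/= big_mkord; apply: ler_sum => j _; rewrite subSS mulrC.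
have s0 := lt_le_trans a_gt0 as_.
apply: ler_pM => //.
- by rewrite exprn_ge0// subr_ge0 ltW.
- exact: B_ge0.
- apply: lerXn2r; rewrite ?nnegrE; first by rewrite subr_ge0 ltW.
    exact: ltW (lt_trans s0 sx).
  by rewrite lerBlDr (le_trans r2)// mulr_natl mulr2n lerD2r ltW.
have xsig : x / sigma < x by rewrite ltr_pdivrMr// ltr_pMr// (lt_trans s0).
have xr' : r <= x * sigma.
  by rewrite (le_trans rsigma)// mulrC ler_pM2r// ltW.
have xs : x / sigma <= s by rewrite ler_pdivrMr// mulrC (le_trans xr).
have ar : a <= x * sigma by rewrite (le_trans as_)// (le_trans (ltW sr)).
have jn : (1 <= j.+1 < n.+1)%N by rewrite (ltn_ord (lift ord0 j)).
have [_ /(_ a _ (lexx a) ar)[M aeM]] := b_Linfty jn.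
apply: (@le_ess_sup_on _ _ _ _ M).
- move=> y; rewrite /= !in_itv/= => /andP[sy yr].
  by rewrite (le_lt_trans xs sy) (lt_le_trans yr xr') itv_ge.
- by move=> y [_]; rewrite /= in_itv/= andbT; exact: b_ge0.
apply: leb_aeS aeM => y H []; rewrite /= !in_itv/= andbT => /andP[_ yx] ay.
by rewrite (le_trans (ler_norm _))// H// ay ltW.
Qed.

Let mq_sub x y : a <= x -> leb_measurable_fun `]x, y] q.
Proof.
move=> ax; apply: measurable_funS (proj1 q_Linfty); first exact: leb_measurable_itv.
by move=> z; rewrite /= !in_itv/= andbT => /andP[/ltW xz _]; exact: le_trans xz.
Qed.

Let mpsi x y : a <= x -> leb_measurable_fun `]x, y] psi.
Proof. by move=> ax; apply: measurable_funM; [exact: mq_sub|exact: measurable_cst]. Qed.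

Let psi_ge0 x : s < x -> 0 <= psi x.
Proof. by move=> /itv_ge ax; rewrite divr_ge0 ?q_ge0// ltW. Qed.

Let mmoment x y (c : R) : a <= x -> leb_measurable_fun `]x, y] (fun z => (z - c) ^+ n * psi z).
Proof.
move=> ax; apply: measurable_funM; last exact: mpsi.
apply: borel_leb_measurable_fun; first exact: measurable_itv.
by apply: measurable_funX; apply: measurable_funB; [exact: measurable_id|exact: measurable_cst].
Qed.

Let moment_le :
  (\int[leb R]_(x in `]s, r]) ((x - s) ^+ n * psi x)%:E <=
    (n`!%:R * (w s - w r) / gam)%:E)%E.
Proof.
have mom0 x : s < x -> 0 <= (x - s) ^+ n * psi x.
  by move=> sx; rewrite mulr_ge0 ?psi_ge0// exprn_ge0// subr_ge0 ltW.
rewrite leb_integral_oo_oc//; last 2 first.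
- exact: mmoment.
- by move=> x /andP[sx _]; exact: mom0.
have aeB j : (j < n)%N -> {ae leb R, forall x : R, s < x < r -> b j.+1 x <= B j}.
  move=> jn; have jn' : (1 <= j.+1 < n.+1)%N by [].
  have [_ /(_ s r as_ (ltW sr))[M aeM]] := b_Linfty jn'.
  have : {ae leb R, forall x : R, `]s, r[%classic x -> b j.+1 x <= B j}.
    apply: (@ess_sup_on_ae_ge _ _ _ M); apply: leb_aeS aeM => x H.
    rewrite /= in_itv/= => /andP[sx xr].
    by rewrite (le_trans (ler_norm _))// H// !ltW.
  by apply: leb_aeS => x H sxr; apply: H; rewrite /= in_itv.
have := solution_window_le as_ sr (ltW gam_gt0) gam_h B_ge0 aeB.
have nf0 : 0 < n`!%:R :> R by rewrite ltr0n fact_gt0.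
have c0 : 0 < gam * D / n`!%:R by rewrite divr_gt0// mulr_gt0.
(* The denominator [D] of [psi] is also the factor in front of the drop of [w], so it cancels. *)
rewrite (_ : (\int[leb R]_(x in _) _)%E = (\int[leb R]_(x in `]s, r[)
    ((gam * D / n`!%:R)%:E * ((x - s) ^+ n * psi x)%:E))%E); last first.
  apply: eq_integral => x _; rewrite -EFinM; congr EFin.
  rewrite /taylor_term /psi; field.
  by rewrite !gt_eqF.
rewrite ge0_integralZl_EFin; last 4 first.
- exact: leb_measurable_itv.
- by move=> x; rewrite /= in_itv/= => /andP[sx _]; rewrite lee_fin mom0.
- apply/measurable_EFinP; apply: measurable_funS (@mmoment s r s as_); first exact: leb_measurable_itv.
  by move=> x; rewrite /= !in_itv/= => /andP[-> /ltW].
- exact: ltW.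
rewrite -/D -lee_pdivlMl// -EFinM.
rewrite (_ : _^-1 * (D * _) = n`!%:R * (w s - w r) / gam)//.
by field; rewrite !gt_eqF.
Qed.

Variables (phi : R -> R) (K A : R).
Hypothesis mphi : leb_measurable_fun setT phi.
Hypothesis phi_ge0 : forall x, 0 <= phi x.
Hypothesis phi_leK : forall x, phi x <= K.
Hypothesis phi_le : forall x, a <= x -> phi x <= weight x.

Let mphi_sub x y : leb_measurable_fun `]x, y] phi.
Proof. by apply: measurable_funS mphi => //; exact: leb_measurable_itv. Qed.

(** The function [nu] of [median_le_moment] is the (n + 1)-th root of the running essential supremum
    [N], which is nondecreasing in [x]. *)
Lemma window_power_le :
  (\int[leb R]_(x in `]s, r]) (phi x)%:E = A%:E)%E ->
  gam * (A / 2) ^+ n.+1 <= n`!%:R * (w s - w r).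
Proof.
move=> intA; have [M aeM] := f_fun_ae_le as_ (ltW sr).
pose N x := ess_sup_on `]s, x[ f.
have fpos x y : `]s, x[%classic y -> 0 <= f y.
  by rewrite /= in_itv/= => /andP[/itv_ge ay _]; exact: f_fun_ge0.
have N0 x : 0 <= N x by apply: ess_sup_on_ge0 => y; exact: fpos.
have aeMx x : x <= r -> {ae leb R, forall y : R, `]s, x[%classic y -> f y <= M}.
  move=> xr; apply: leb_aeS aeM => y H; rewrite /= in_itv/= => /andP[sy yx].
  by apply: H; rewrite ltW// (le_trans (ltW yx)).
rewrite mulrC -ler_pdivlMr//.
apply: (@median_le_moment _ n phi psi (fun x => N x `^ n.+1%:R^-1) K A _ s r).
- exact: ltW.
- exact: mphi_sub.
- by [].
- by [].
- exact: mpsi.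
- by move=> y /andP[sy _]; exact: psi_ge0.
- by move=> x _; exact: powR_ge0.
- move=> x y sx xy yr; apply: ge0_ler_powR; rewrite ?nnegrE ?invr_ge0 ?ler0n ?N0//.
  apply: (@le_ess_sup_on _ _ _ _ M); [|exact: fpos|exact: aeMx].
  by move=> z; rewrite /= !in_itv/= => /andP[-> /lt_le_trans]; apply.
- have aefN : {ae leb R, forall x : R, s < x < r -> f x <= N x}.
    apply: (@ess_sup_on_left_ae_ge _ _ M).
    by apply: leb_aeS aeM => x H /andP[sx xr]; apply: H; rewrite !ltW.
  apply: leb_aeS aefN => x H sxr; have /andP[sx xr] := sxr; have ax := itv_ge sx.
  have x0 := lt_le_trans a_gt0 ax.
  have xs : x / sigma <= s by rewrite ler_pdivrMr// mulrC (le_trans (ltW xr)).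
  (* As [x / sigma <= s], the interval []s, x[] lies in the one over which [mu_fun] takes its
     supremum. *)
  have Nmu : 1 + x ^+ n.+1 * N x <= mu x.
    apply: mu_fun_ge => //.
    have [M' aeM'] := f_fun_ae_le (lexx a) ax.
    apply: (@le_ess_sup_on _ _ _ _ M').
    + move=> y; rewrite /= !in_itv/= => /andP[sy ->].
      by rewrite (le_lt_trans xs sy) itv_ge.
    + by move=> y [_]; rewrite /= in_itv/= andbT; exact: f_fun_ge0.
    apply: leb_aeS aeM' => y H' []; rewrite /= !in_itv/= andbT => /andP[_ yx] ay.
    by apply: H'; rewrite ay ltW.
  have [W1 W2] := weight_bounds x0 (f_fun_ge0 ax) (N0 x) Nmu.
  split; last exact: le_trans (phi_le ax) (W2 (H sxr)).
  have xr' : s < x <= r by rewrite sx ltW.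
  apply: le_trans (f_fun_le_psi xr'); apply: le_trans W1.
  by apply: ler_wpM2r; [rewrite exprn_ge0// powR_ge0|exact: phi_le].
- exact: intA.
- exact: moment_le.
Qed.

Lemma window_tail_le (lam r1 : R) : 1 < lam -> lam * s <= r1 -> s <= r1 -> r1 <= r ->
  (\int[leb R]_(x in `]r1, r]) (phi x)%:E = A%:E)%E ->
  gam * A <= (lam / (lam - 1)) ^+ n * (n`!%:R * (w s - w r)).
Proof.
move=> lam1 lams sr1 r1r intA.
have c0 : 0 <= (lam / (lam - 1)) ^+ n by rewrite exprn_ge0// divr_ge0; lra.
have ar1 : a <= r1 by exact: le_trans sr1.
rewrite mulrC -ler_pdivlMr// -mulrA -lee_fin -intA EFinM.
apply: le_trans (lee_wpmul2l _ moment_le); last by rewrite lee_fin.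
have mom0 x : s < x -> 0 <= (x - s) ^+ n * psi x.
  by move=> sx; rewrite mulr_ge0 ?psi_ge0// exprn_ge0// subr_ge0 ltW.
rewrite -ge0_integralZl_EFin; last 4 first.
- exact: leb_measurable_itv.
- by move=> x; rewrite /= in_itv/= => /andP[sx _]; rewrite lee_fin mom0.
- apply/measurable_EFinP; exact: mmoment.
- exact: c0.
under [leRHS]eq_integral do rewrite -EFinM.
have mm x y : a <= x ->
    leb_measurable_fun `]x, y] (fun z => (lam / (lam - 1)) ^+ n * ((z - s) ^+ n * psi z)).
  by move=> ax; apply: measurable_funM; [exact: measurable_cst|exact: mmoment].
have mm0 x : s < x -> 0 <= (lam / (lam - 1)) ^+ n * ((x - s) ^+ n * psi x).
  by move=> sx; rewrite mulr_ge0 ?mom0.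
rewrite [leRHS](leb_integral_split sr1 r1r); [|exact: mm|by move=> y /andP[/mm0]].
rewrite -[leLHS]add0e; apply: leeD.
  by apply: leb_integral_ge0 => y /andP[/mm0].
apply: leb_integral_le.
- exact: mphi_sub.
- exact: mm.
- by [].
- by move=> y /andP[r1y _]; apply: mm0; exact: le_lt_trans r1y.
apply: leb_aeW => x /andP[r1x xr]; have sx := le_lt_trans sr1 r1x.
have ax := itv_ge sx; have x0 : 0 <= x := le_trans (ltW a_gt0) ax.
apply: (le_trans (phi_le ax)).
have /andP[_ wl] := weight_le n x0 (f_fun_ge0 ax) (mu_fun_ge1 ax).
apply: (le_trans wl); rewrite [leRHS]mulrA -exprMn; apply: ler_pM.
- exact: exprn_ge0.
- exact: f_fun_ge0.
- apply: lerXn2r; rewrite ?nnegrE//.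
    by rewrite mulr_ge0 ?divr_ge0 ?subr_ge0 ?(ltW lam1) ?(ltW sx)// (le_trans ler01)// ltW.
  rewrite mulrAC ler_pdivlMr ?subr_gt0//; lra.
- by apply: f_fun_le_psi; rewrite sx ltW.
Qed.

End Estimates.

End SolutionWindow.

(** * The functions h and g, and the primitive of the convergent integrand *)

Section Nonlinearity.
Context {R : realType}.
Variables (n : nat) (theta : R) (h : R -> R).
Hypotheses (theta_gt1 : 1 < theta) (h_gt0 : forall t, 0 < t -> 0 < h t).
Hypothesis h_cont : {within `]0, +oo[, continuous h}.

Local Notation g := (g_fun theta h).
Local Notation kernel t := (g t `^ (- n.+1%:R^-1) * t `^ (n.+1%:R^-1 - 1)).

Let theta_gt0 : 0 < theta. Proof. exact: lt_trans theta_gt1. Qed.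

Lemma h_lower_bound (al be : R) : 0 < al -> al <= be ->
  exists2 c : R, 0 < c & forall t, al <= t <= be -> c <= h t.
Proof.
move=> al0 albe.
have ch : {within `[al, be], continuous h}.
  apply: continuous_subspaceW h_cont => x; rewrite /= !in_itv/= andbT => /andP[].
  by move=> /(lt_le_trans al0).
have [c cab hc] := EVT_min albe ch.
exists (h c); last by move=> t abt; apply: hc; rewrite in_itv.
by apply: h_gt0; move: cab; rewrite in_itv/= => /andP[/(lt_le_trans al0)].
Qed.

Let window_gt0 (t tau : R) : 0 < t -> t / theta < tau -> 0 < tau.
Proof. by move=> t0; apply: lt_trans; rewrite divr_gt0. Qed.

Let window_mid (t : R) : 0 < t -> t / theta < t < theta * t.
Proof. by move=> t0; rewrite ltr_pdivrMr// ltr_pMr// ltr_pMl// theta_gt1. Qed.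

Let has_inf_window (t : R) : 0 < t -> has_inf (h @` `]t / theta, theta * t[).
Proof.
move=> t0; split; first by exists (h t); exists t => //; rewrite /= in_itv/= window_mid.
exists 0 => _ [tau + <-]; rewrite /= in_itv/= => /andP[/(window_gt0 t0) tau0 _].
by rewrite ltW// h_gt0.
Qed.

Lemma g_fun_le (t tau : R) : 0 < t -> t / theta < tau -> tau < theta * t -> g t <= h tau.
Proof.
move=> t0 ttau taut; apply: ge_inf; first by have [] := has_inf_window t0.
by exists tau => //; rewrite /= in_itv/= ttau.
Qed.

Lemma g_fun_lower_bound (al be : R) : 0 < al -> al <= be ->
  exists2 c : R, 0 < c & forall t, al <= t <= be -> c <= g t.
Proof.
move=> al0 albe.
have [| |c c0 Hc] := @h_lower_bound (al / theta) (theta * be).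
- by rewrite divr_gt0.
- have /andP[h1 _] := window_mid al0.
  have /andP[_ h2] := window_mid (lt_le_trans al0 albe).
  by rewrite (le_trans (ltW h1))// (le_trans albe)// ltW.
exists c => // t /andP[alt tbe]; have t0 := lt_le_trans al0 alt.
apply: lb_le_inf; first by have [] := has_inf_window t0.
move=> _ [tau + <-]; rewrite /= in_itv/= => /andP[ttau taut]; apply: Hc.
rewrite (le_trans _ (ltW ttau)) ?ler_pM2r ?invr_gt0//=.
by rewrite (le_trans (ltW taut))// ler_pM2l.
Qed.

Lemma g_fun_gt0 (t : R) : 0 < t -> 0 < g t.
Proof.
move=> t0; have [c c0 Hc] := g_fun_lower_bound t0 (lexx t).
by rewrite (lt_le_trans c0)// Hc ?lexx.
Qed.

(** [g] is upper semicontinuous: t / theta < tau < theta t means tau / theta < t < theta tau, so a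
    strict sublevel set is a union of open intervals. *)
Lemma measurable_g_fun : measurable_fun (`]0, +oo[ : set R) g.
Proof.
move=> mD; apply: (measurability _ (RGenInftyO.measurableE R)) => // _ [_ [c ->] <-].
pose U := \bigcup_(tau in [set tau | 0 < tau /\ h tau < c]) `]tau / theta, theta * tau[%classic.
have -> : `]0, +oo[ `&` g @^-1` `]-oo, c[ = `]0, +oo[ `&` U.
  apply/seteqP; split => t []; rewrite /= !in_itv/= andbT => t0.
    move=> gtc; split => //.
    have [_ [tau + <-] htau] := inf_lt (proj1 (has_inf_window t0)) gtc.
    rewrite /= in_itv/= => /andP[ttau taut]; exists tau.
      by split => //; exact: window_gt0 ttau.
    rewrite /= in_itv/=; apply/andP; split.
      by rewrite ltr_pdivrMr// mulrC.
    by rewrite mulrC -ltr_pdivrMr.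
  move=> [tau [tau0 htau]]; rewrite /= in_itv/= => /andP[h1 h2]; split => //.
  apply: le_lt_trans htau; apply: g_fun_le => //.
    by rewrite ltr_pdivrMr// mulrC.
  by rewrite mulrC -ltr_pdivrMr.
apply: measurableI; first exact: measurable_itv.
by apply: open_measurable; apply: bigcup_open => tau _; exact: interval_open.
Qed.

Lemma measurable_kernel (al be : R) : 0 <= al ->
  leb_measurable_fun `]al, be] (fun t => kernel t).
Proof.
move=> al0; apply: borel_leb_measurable_fun; first exact: measurable_itv.
apply: measurable_funM; apply: measurableT_comp (measurable_powR _) _.
  apply: measurable_funS measurable_g_fun; first exact: measurable_itv.
  by move=> x; rewrite /= !in_itv/= andbT => /andP[/(le_lt_trans al0)].
exact: measurable_id.
Qed.

Lemma kernel_ge0 t : 0 <= kernel t. Proof. by rewrite mulr_ge0 ?powR_ge0. Qed.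

Lemma kernel_ge (al be X Y t : R) : 0 < X -> 0 < Y -> 0 < t -> t <= be -> X * g t <= Y ->
  ((Y / X) `^ n.+1%:R^-1)^-1 * (be `^ n.+1%:R^-1 ^+ n)^-1 <= kernel t.
Proof.
move=> X0 Y0 t0 tbe Xg; have g0 := g_fun_gt0 t0; have be0 := lt_le_trans t0 tbe.
have m0 : 0 <= n.+1%:R^-1 :> R by rewrite invr_ge0 ler0n.
rewrite powR_invn_sub1// powRN.
have YX : 0 < Y / X by rewrite divr_gt0.
apply: ler_pM.
- by rewrite invr_ge0 powR_ge0.
- by rewrite invr_ge0 exprn_ge0// powR_ge0.
- rewrite lef_pV2 ?posrE ?powR_gt0//; apply: ge0_ler_powR; rewrite ?nnegrE ?(ltW g0) ?(ltW YX)//.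
  by rewrite ler_pdivlMr// mulrC.
- rewrite lef_pV2 ?posrE ?exprn_gt0 ?powR_gt0//.
  apply: lerXn2r; rewrite ?nnegrE ?powR_ge0//.
  by apply: ge0_ler_powR; rewrite ?nnegrE ?(ltW t0) ?(ltW be0).
Qed.

Hypothesis g_int : (\int[leb R]_(t in `]0%R, 1%R[) (kernel t)%:E < +oo)%E.

(** Finiteness is assumed up to 1 only; from 1 to [V] the kernel is bounded because [g] has a
    positive lower bound there. *)
Let kernel_int_fin al be : 0 <= al ->
  (\int[leb R]_(t in `]al, be]) (kernel t)%:E)%E \is a fin_num.
Proof.
move=> al0; pose V := Num.max be 1.
have V1 : 1 <= V by rewrite le_max lexx orbT.
have mk x y : 0 <= x -> measurable_fun (`]x, y]%classic : set (lebR R)) (fun t => (kernel t)%:E).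
  by move=> x0; apply/measurable_EFinP; exact: measurable_kernel.
rewrite ge0_fin_numE; last by apply: leb_integral_ge0 => t _; exact: kernel_ge0.
apply: (@le_lt_trans _ _ (\int[leb R]_(t in `]0%R, V]) (kernel t)%:E)%E).
  apply: ge0_subset_integral.
  - exact: leb_measurable_itv.
  - exact: leb_measurable_itv.
  - exact: mk.
  - by move=> t _; rewrite lee_fin kernel_ge0.
  - move=> t; rewrite /= !in_itv/= => /andP[/(le_lt_trans al0) -> tbe].
    by rewrite le_max tbe.
rewrite (leb_integral_split ler01 V1); last 2 first.
- exact: measurable_kernel.
- by move=> t _; exact: kernel_ge0.
apply: lte_add_pinfty.
  rewrite leb_integral_oo_oc//; first exact: measurable_kernel.
  by move=> t _; exact: kernel_ge0.
have [c c0 Hc] := g_fun_lower_bound ltr01 V1.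
have [|||_ fin] := @leb_integral_fin_num _ (fun t => kernel t) (c `^ n.+1%:R^-1)^-1 1 V V1.
- by apply: measurable_kernel; exact: ler01.
- by move=> t _; exact: kernel_ge0.
- apply: leb_aeW => t /andP[t1 tV]; have t0 : 0 < t := lt_trans ltr01 t1.
  have cg : c <= g t by apply: Hc; rewrite !ltW.
  have m0 : 0 <= n.+1%:R^-1 :> R by rewrite invr_ge0 ler0n.
  rewrite powR_invn_sub1// powRN -[leRHS]mulr1; apply: ler_pM.
  + by rewrite invr_ge0 powR_ge0.
  + by rewrite invr_ge0 exprn_ge0// powR_ge0.
  + rewrite lef_pV2 ?posrE ?powR_gt0 ?g_fun_gt0//; apply: ge0_ler_powR => //.
      by rewrite nnegrE ltW.
    by rewrite nnegrE ltW// g_fun_gt0.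
  + have r1 : 1 <= t `^ n.+1%:R^-1.
      have := @ge0_ler_powR _ _ m0 1 t; rewrite powR1 !nnegrE; apply => //; exact: ltW.
    by rewrite invf_le1 ?exprn_ege1// exprn_gt0// (lt_le_trans ltr01).
- by move: fin; rewrite ge0_fin_numE// leb_integral_ge0// => t _; exact: kernel_ge0.
Qed.

Definition kernel_primitive (y : R) : R := fine (\int[leb R]_(t in `]0%R, y]) (kernel t)%:E)%E.

Local Notation G := kernel_primitive.

Lemma kernel_primitive_ge0 y : 0 <= G y.
Proof. by apply: fine_ge0; apply: leb_integral_ge0 => t _; exact: kernel_ge0. Qed.

Let kernel_primitiveB al be : 0 <= al -> al <= be ->
  (G be - G al)%:E = (\int[leb R]_(t in `]al, be]) (kernel t)%:E)%E.
Proof.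
move=> al0 albe; rewrite EFinB !fineK ?kernel_int_fin//.
rewrite [X in (X - _)%E](leb_integral_split al0 albe).
- by rewrite addeAC subee ?add0e// kernel_int_fin.
- exact: measurable_kernel.
- by move=> t _; exact: kernel_ge0.
Qed.

Lemma kernel_primitive_le al be : 0 <= al -> al <= be -> G al <= G be.
Proof.
move=> al0 albe; rewrite -subr_ge0 -lee_fin kernel_primitiveB//.
by apply: leb_integral_ge0 => t _; exact: kernel_ge0.
Qed.

(** The bounds g <= Y / X and t <= be give a constant lower bound on the kernel. Raising the
    integrated inequality to the power n + 1 removes all roots. *)
Lemma kernel_primitive_increase (al be X Y : R) : 0 < al -> al <= be -> 0 <= X -> 0 < Y ->
  (forall t, al < t < be -> X * g t <= Y) ->
  X * (be - al) ^+ n.+1 <= (G be - G al) ^+ n.+1 * Y * be ^+ n.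
Proof.
move=> al0 albe X0 Y0 Xg; have be0 := lt_le_trans al0 albe.
have GG : 0 <= G be - G al by rewrite subr_ge0 kernel_primitive_le// ltW.
have [->|Xn0] := eqVneq X 0.
  by rewrite mul0r !mulr_ge0 ?exprn_ge0// ltW.
have {X0}X0 : 0 < X by rewrite lt_neqAle eq_sym Xn0.
pose c := ((Y / X) `^ n.+1%:R^-1)^-1 * (be `^ n.+1%:R^-1 ^+ n)^-1.
have c0 : 0 <= c by rewrite mulr_ge0 ?invr_ge0 ?exprn_ge0 ?powR_ge0.
have cG : c * (be - al) <= G be - G al.
  rewrite -lee_fin kernel_primitiveB ?(ltW al0)// -leb_integral_cst//.
  apply: leb_integral_le.
  - exact: measurable_cst.
  - by apply: measurable_kernel; exact: ltW.
  - by [].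
  - by move=> t _; exact: kernel_ge0.
  apply: leb_aeW => t /andP[alt tbe]; apply: kernel_ge => //.
  - exact: lt_trans alt.
  - exact: ltW.
  - by apply: Xg; rewrite alt.
have cm : c ^+ n.+1 = X / (Y * be ^+ n).
  rewrite /c exprMn !exprVn rootXn; last by rewrite divr_ge0 ?ltW.
  rewrite exprAC rootXn; last exact: ltW.
  by rewrite invf_div -mulrA -invfM.
have Yb : 0 < Y * be ^+ n by rewrite mulr_gt0// exprn_gt0.
rewrite -mulrA -ler_pdivrMr// mulrAC -cm -exprMn.
by apply: lerXn2r => //; rewrite nnegrE mulr_ge0// subr_ge0.
Qed.

(* Since [g <= h tau] on (tau / theta, tau), a small ratio [h tau / tau] would make
   the integral over that interval large. *)
Lemma h_ge_linear (W : R) : exists2 kap : R, 0 < kap &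
  forall tau, 0 < tau -> tau <= W -> kap * tau <= h tau.
Proof.
have t1 : 0 < 1 - theta^-1 by rewrite subr_gt0 invf_lt1.
have G1 := kernel_primitive_ge0 1.
(* In the estimate below the power [tau ^+ n] cancels and the increase of [G] is at most [G 1]; the
   added 1 keeps the denominator positive. *)
pose k1 := (1 - theta^-1) ^+ n.+1 / (G 1 ^+ n.+1 + 1).
have d0 : 0 < G 1 ^+ n.+1 + 1 by rewrite ltr_wpDl// exprn_ge0.
have k10 : 0 < k1 by rewrite divr_gt0// exprn_gt0.
have H1 tau : 0 < tau -> tau <= 1 -> k1 * tau <= h tau.
  move=> tau0 tau1; have ht := h_gt0 tau0.
  have /andP[tt _] := window_mid tau0.
  have tt0 : 0 < tau / theta by rewrite divr_gt0.
  have H : 1 * (tau - tau / theta) ^+ n.+1 <=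
      (G tau - G (tau / theta)) ^+ n.+1 * h tau * tau ^+ n.
    apply: kernel_primitive_increase => //; first exact: ltW.
    move=> t /andP[h1 h2]; rewrite mul1r; have t0 := lt_trans tt0 h1.
    apply: g_fun_le => //; first by apply: lt_trans tt; rewrite ltr_pM2r ?invr_gt0.
    by move: h1; rewrite ltr_pdivrMr// mulrC.
  have tn0 : 0 < tau ^+ n by rewrite exprn_gt0.
  have H2 : tau * (1 - theta^-1) ^+ n.+1 <= (G tau - G (tau / theta)) ^+ n.+1 * h tau.
    rewrite -(ler_pM2r tn0) (le_trans _ H)// mul1r.
    have -> : tau - tau / theta = tau * (1 - theta^-1) by rewrite mulrBr mulr1.
    by rewrite [leRHS]exprMn [tau ^+ n.+1]exprS mulrAC.
  have GG : (G tau - G (tau / theta)) ^+ n.+1 <= G 1 ^+ n.+1 + 1.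
    apply: (@le_trans _ _ (G 1 ^+ n.+1)); last by rewrite lerDl.
    apply: lerXn2r; rewrite ?nnegrE// ?subr_ge0.
      by apply: kernel_primitive_le; exact: ltW.
    rewrite lerBlDr (le_trans (kernel_primitive_le (ltW tau0) tau1))// lerDl.
    exact: kernel_primitive_ge0.
  rewrite /k1 mulrAC ler_pdivrMr// mulrC (le_trans H2)// mulrC.
  by apply: ler_wpM2l => //; exact: ltW.
have [W1|W1] := leP W 1.
  by exists k1 => // tau tau0 tauW; apply: H1 => //; exact: le_trans W1.
have W0 : 0 < W := lt_trans ltr01 W1.
(* Between 1 and [W] compactness gives h >= c, hence h(tau) >= (c / W) tau. *)
have [c c0 Hc] := h_lower_bound ltr01 (ltW W1).
exists (Num.min k1 (c / W)); first by rewrite lt_min k10 divr_gt0.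
move=> tau tau0 tauW; have [tau1|tau1] := leP tau 1.
  apply: le_trans (H1 tau tau0 tau1); apply: ler_wpM2r; first exact: ltW.
  by rewrite ge_min lexx.
have ct : c <= h tau by apply: Hc; rewrite ltW.
apply: le_trans ct; apply: (@le_trans _ _ (c / W * tau)).
  apply: ler_wpM2r; first exact: ltW.
  by rewrite ge_min lexx orbT.
by rewrite mulrAC ler_pdivrMr// ler_pM2l.
Qed.

End Nonlinearity.

(** * Simple functions below a function with infinite integral *)

Section Exhaustion.
Context {R : realType}.
Import HBNNSimple.

(** The integral of a nonnegative function is the supremum over the simple functions below it, so
    one of these has integral above [C]; monotone convergence along [c] then finds [k]. *)
Lemma infinite_integral_simple (a C : R) (F : R -> R) (c : nat -> R) :
  (forall x, a <= x -> 0 <= F x) ->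
  (\int[leb R]_(x in `[a, +oo[) (F x)%:E = +oo)%E ->
  (forall i j, (i <= j)%N -> c i <= c j) -> (forall M, exists k, M < c k) ->
  exists phi, [/\ leb_measurable_fun setT phi, (forall x, 0 <= phi x),
    (exists K, forall x, phi x <= K), (forall x, a <= x -> phi x <= F x) &
    exists k, (C%:E < \int[leb R]_(x in `]a, c k]) (phi x)%:E)%E].
Proof.
move=> F0 intF c_nd c_unb.
rewrite ge0_integralE in intF; last first.
  by move=> x; rewrite /= in_itv/= andbT lee_fin; exact: F0.
have := ltry C; rewrite -intF => /ereal_sup_gt[_ [/= phi phiF <-] Cphi].
exists (phi : R -> R); have mphi : leb_measurable_fun setT phi by exact: measurable_funP.
have phi0 x : 0 <= phi x by exact: fun_ge0.
have phiD x : phi x <= if a <= x then F x else 0.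
  have := phiF x; rewrite /patch mem_setE in_itv/= andbT.
  by case: ifP => _; rewrite lee_fin.
split => //.
- have [K [_ HK]] := simple_bounded phi.
  exists (K + 1) => x; rewrite (le_trans (ler_norm _))//.
  by apply: (HK (K + 1)) => //; rewrite ltrDl.
- by move=> x ax; have := phiD x; rewrite ax.
apply: contrapT => noK; move: Cphi; rewrite ltNge => /negP; apply.
pose D k : set (lebR R) := `]a, c k]%classic.
have mp (A : set R) : measurable_fun (A : set (lebR R)) (fun x => (phi x)%:E).
  by apply/measurable_EFinP; exact: measurable_funS mphi.
have cvgI : (\int[leb R]_(x in D k) (phi x)%:E)%E @[k --> \oo] -->
    (\int[leb R]_(x in \bigcup_k D k) (phi x)%:E)%E.
  apply: ge0_nondecreasing_set_cvg_integral.
  - move=> i j ij; apply/subsetPset => x; rewrite /D/= !in_itv/= => /andP[-> xc].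
    exact: le_trans (c_nd _ _ ij).
  - by move=> i; exact: leb_measurable_itv.
  - by move=> i; exact: mp.
  - by move=> i x _; rewrite lee_fin.
rewrite -integralT_nnsfun.
(* The intervals []a, c k]] miss the point [a], which is removed as a null set; left of [a] the
   function [phi] is 0. *)
rewrite (@ge0_negligible_integral _ _ _ _ _ (`[a, a]%classic : set (lebR R))); last 5 first.
- exact: leb_measurable_itv.
- exact: measurableT.
- exact: mp.
- by move=> x _; rewrite lee_fin.
- by have := leb_itv_bnd true false (lexx a); rewrite subrr.
have -> : (\int[leb R]_(x in setT `\` `[a, a]) (phi x)%:E =
    \int[leb R]_(x in \bigcup_k D k) (phi x)%:E)%E.
  rewrite integral_mkcond [RHS]integral_mkcond; apply: eq_integral => x _.
  rewrite /patch; have [ax|xa] := ltP a x.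
    rewrite !mem_set//.
      have [k xk] := c_unb x; exists k => //.
      by rewrite /D/= in_itv/= ax ltW.
    split => //; rewrite /= in_itv/= => /andP[_].
    by rewrite leNgt ax.
  rewrite [in RHS]memNset; last first.
    by move=> [k _]; rewrite /D/= in_itv/= => /andP[/lt_le_trans /(_ xa)]; rewrite ltxx.
  case: ifPn => // /set_mem[_]; rewrite /= in_itv/= xa andbT => /negP.
  move=> axN; have := phiD x; rewrite (negbTE axN) => phix.
  by congr EFin; apply/eqP; rewrite eq_le phix phi0.
rewrite -(cvg_lim _ cvgI)//; apply: lime_le; first by apply/cvg_ex; eexists; exact: cvgI.
apply: nearW => k; rewrite leNgt; apply/negP => Ck.
by apply: noK; exists k.
Qed.

End Exhaustion.

(** * Elementary inequalities and the choice of one step *)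

Section RealLemmas.
Context {R : realType}.
Implicit Types (A J c tau : R).

(** [1 + c] stands in for the root of [c], as c <= (1 + c)^(n+1). *)
Lemma root_bound n A J c : 0 <= J -> 0 <= c ->
  A ^+ n.+1 <= J ^+ n.+1 * c -> A <= (1 + c) * J.
Proof.
move=> J0 c0 H; rewrite leNgt; apply/negP => lt.
have cJ0 : 0 <= (1 + c) * J by rewrite mulr_ge0// addr_ge0.
have A0 : 0 < A := le_lt_trans cJ0 lt.
have : ((1 + c) * J) ^+ n.+1 < A ^+ n.+1 by rewrite ltrXn2r ?nnegrE// ltW.
rewrite ltNge => /negP; apply; apply: (le_trans H).
rewrite exprMn mulrC; apply: ler_wpM2r; first exact: exprn_ge0.
have c1 : 1 <= 1 + c by rewrite lerDl.
rewrite exprS (le_trans (y := 1 + c)) ?lerDr//.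
by rewrite -[leLHS]mulr1; apply: ler_wpM2l; [exact: le_trans c1|rewrite exprn_ege1].
Qed.

Lemma exists_sqrt_below tau : 1 < tau -> exists2 rho, 1 < rho & rho * rho < tau.
Proof.
move=> tau1; pose e := Num.min ((tau - 1) / 4) 1.
have e0 : 0 < e by rewrite lt_min ltr01 andbT divr_gt0// subr_gt0.
have e1 : e <= 1 by rewrite ge_min lexx orbT.
have e2 : e <= (tau - 1) / 4 by rewrite ge_min lexx.
exists (1 + e); first by rewrite ltrDl.
have : e * e <= e by rewrite -[leRHS]mulr1; apply: ler_wpM2l => //; exact: ltW.
have -> : (1 + e) * (1 + e) = 1 + 2 * e + e * e by ring.
lra.
Qed.

(** Go to [rho * s] unless [w] has dropped there by more than the factor [th]; in that case stop
    where it has dropped by exactly [th]. *)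
Lemma step_exists (w : R -> R) (a rho th s : R) : 0 < a -> 1 < rho -> 1 < th ->
  (forall x y, a <= x -> x <= y -> {within `[x, y], continuous w}) ->
  (forall x y, a <= x -> x <= y -> w y <= w x) -> (forall x, a <= x -> 0 < w x) ->
  a <= s -> exists r, [/\ s < r, r <= rho * s, w s <= th * w r &
    r = rho * s \/ w s = th * w r].
Proof.
move=> a0 rho1 th1 cw w_ni w0 as_; have s0 : 0 < s := lt_le_trans a0 as_.
have srho : s < rho * s by rewrite ltr_pMl.
have th0 : 0 < th := lt_trans ltr01 th1.
have [wle|wlt] := leP (w s) (th * w (rho * s)).
  by exists (rho * s); split => //; left.
have ws := w0 s as_.
have wd : w s / th < w s by rewrite ltr_pdivrMr// ltr_pMr.
have [|r] := IVT (ltW srho) (cw s (rho * s) as_ (ltW srho)) (v := w s / th).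
  apply/andP; split; last by rewrite le_max (ltW wd).
  by rewrite ge_min; apply/orP; right; rewrite ler_pdivlMr// mulrC ltW.
rewrite in_itv/= => /andP[sr rr] wr.
have E : w s = th * w r by rewrite wr mulrC divfK// gt_eqF.
exists r; split => //; last by right.
- rewrite lt_neqAle sr andbT; apply/eqP => sr'.
  by move: wd; rewrite -wr -sr' ltxx.
- by rewrite -E.
Qed.

End RealLemmas.

Lemma solution_nonincreasing (R : realType) (m : nat) (a : R) (Q : R -> 'rV[R]_m -> R)
    (w : R -> R) x y : (1 < m)%N -> is_solution a Q w -> a <= x -> x <= y -> w y <= w x.
Proof.
move=> m1 [dw acw _ sgw] ax xy; have m0 : (0 < m)%N := ltnW m1.
apply: (ac_slope_le0 xy (acw 0%N m0 x y ax xy)).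
apply: leb_aeW => z /andP[xz zy]; have az := le_lt_trans ax xz.
have m10 : (0 < m.-1)%N by rewrite -ltnS prednK.
have D := derivable_from_is_derive az (dw 0%N z m10 (ltW az)).
apply: slope_le_trans (is_derive_slope_le D).
by have := sgw 1%N z m1 (ltW az); rewrite expr1 mulN1r oppr_ge0.
Qed.

(** * Excluding a solution that stays positive *)

Section NoPositiveSolution.
Context {R : realType}.
Variables (n : nat) (a theta sigma : R) (Q : R -> 'rV[R]_n.+1 -> R) (q : R -> R).
Variables (b : nat -> R -> R) (h w : R -> R).
Hypotheses (n_gt0 : (0 < n)%N) (a_gt0 : 0 < a).
Hypotheses (theta_gt1 : 1 < theta) (sigma_gt1 : 1 < sigma).
Hypothesis q_ge0 : forall r, a <= r -> 0 <= q r.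
Hypothesis q_Linfty : Linfty_loc a q.
Hypothesis b_ge0 : forall i r, (1 <= i < n.+1)%N -> a <= r -> 0 <= b i r.
Hypothesis b_Linfty : forall i, (1 <= i < n.+1)%N -> Linfty_loc a (b i).
Hypothesis h_gt0 : forall t, 0 < t -> 0 < h t.
Hypothesis h_cont : {within `]0, +oo[, continuous h}.
Hypothesis Q_ge : forall (r : R) (t : nat -> R), a <= r -> 0 < t 0%N ->
  (forall i, (1 <= i < n.+1)%N -> 0 <= (-1) ^+ i * t i) ->
  (-1) ^+ n.+1 * Q r (\row_(i < n.+1) t i) >=
    q r * h (t 0%N) - \sum_(1 <= i < n.+1) b i r * `|t i|.
Hypothesis w_sol : is_solution a Q w.
Hypothesis w_gt0 : forall r, a <= r -> 0 < w r.
Hypothesis g_int : (\int[leb R]_(t in `]0%R, 1%R[)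
  (g_fun theta h t `^ (- n.+1%:R^-1) * t `^ (n.+1%:R^-1 - 1))%:E < +oo)%E.

Local Notation weight x := (x ^+ n * f_fun n.+1 a sigma q b x *
  mu_fun n.+1 a sigma q b x `^ (n.+1%:R^-1 - 1)).
Local Notation G := (kernel_primitive n theta h).

Let w_ni x y : a <= x -> x <= y -> w y <= w x.
Proof. exact: solution_nonincreasing w_sol. Qed.

Let G_le al be : 0 <= al -> al <= be -> G al <= G be.
Proof. exact: kernel_primitive_le. Qed.

Let nf_gt0 : 0 < n`!%:R :> R. Proof. by rewrite ltr0n fact_gt0. Qed.

Section Pair.
Variables (phi : R -> R) (K A s r : R).
Hypothesis mphi : leb_measurable_fun setT phi.
Hypothesis phi_ge0 : forall x, 0 <= phi x.
Hypothesis phi_leK : forall x, phi x <= K.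
Hypothesis phi_le : forall x, a <= x -> phi x <= weight x.
Hypotheses (as_ : a <= s) (sr : s < r) (rsigma : r <= sigma * s) (r2 : r <= 2 * s).
Hypothesis wtheta : w s < theta * w r.

Let ar : a <= r. Proof. exact: le_trans as_ (ltW sr). Qed.
Let wr_gt0 : 0 < w r. Proof. exact: w_gt0. Qed.
Let ws_gt0 : 0 < w s. Proof. exact: w_gt0. Qed.
Let wrs : w r <= w s. Proof. by apply: w_ni => //; exact: ltW. Qed.
Let J_ge0 : 0 <= G (w s) - G (w r).
Proof. by rewrite subr_ge0; apply: G_le => //; exact: ltW. Qed.

(** Both [t] and [w x] lie in [w r, w s], whose ends differ by a factor below [theta], so [w x] is
    in the interval over which [g] takes its infimum at [t]. *)
Let g_le_h t : w r < t < w s -> forall x, s <= x <= r -> g_fun theta h t <= h (w x).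
Proof.
move=> /andP[rt ts] x /andP[sx xr]; have t0 := lt_trans wr_gt0 rt.
have th0 : 0 < theta := lt_trans ltr01 theta_gt1.
have h1 : w r <= w x by apply: w_ni => //; exact: le_trans sx.
have h2 : w x <= w s by exact: w_ni.
apply: g_fun_le => //.
  by rewrite ltr_pdivrMr// mulrC (lt_trans ts)// (lt_le_trans wtheta)// ler_pM2l.
by rewrite (le_lt_trans h2)// (lt_trans wtheta)// ltr_pM2l.
Qed.

Let g_gt0 t : w r < t < w s -> 0 < g_fun theta h t.
Proof. by move=> /andP[rt _]; apply: g_fun_gt0 => //; exact: lt_trans rt. Qed.

(** The median estimate bounds (A/2)^(n+1) g(t) by n! D, D being the drop, so
    [kernel_primitive_increase] yields (A/2)^(n+1) D^n <= n! J^(n+1) w(s)^n, and D >= delta w(s)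
    cancels the power of w(s). *)
Lemma integral_le_of_drop (delta : R) : 0 < delta -> delta * w s <= w s - w r ->
  (\int[leb R]_(x in `]s, r]) (phi x)%:E = A%:E)%E ->
  A <= 2 * (1 + n`!%:R / delta ^+ n) * (G (w s) - G (w r)).
Proof.
move=> delta0 dle intA; set J := G (w s) - G (w r); set D := w s - w r in dle *.
have D0 : 0 < D by rewrite (lt_le_trans _ dle)// mulr_gt0.
have A0 : 0 <= A by rewrite -lee_fin -intA leb_integral_ge0.
have A2 : 0 <= A / 2 by rewrite divr_ge0.
have Y0 : 0 < n`!%:R * D by rewrite mulr_gt0.
have := kernel_primitive_increase theta_gt1 h_gt0 h_cont g_int wr_gt0 wrs
  (exprn_ge0 n.+1 A2) Y0.
have Hg t : w r < t < w s -> (A / 2) ^+ n.+1 * g_fun theta h t <= n`!%:R * D.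
  move=> rts; rewrite mulrC.
  exact: (window_power_le q_ge0 q_Linfty b_ge0 b_Linfty Q_ge w_sol w_gt0 a_gt0
    sigma_gt1 as_ sr rsigma r2 (g_gt0 rts) (g_le_h rts) mphi phi_ge0 phi_leK phi_le intA).
move=> /(_ Hg); rewrite -/J -/D => H.
rewrite -mulrA [2 * _]mulrC -ler_pdivrMr//.
have dn0 : 0 < delta ^+ n by rewrite exprn_gt0.
apply: (@root_bound _ n) => //; first by rewrite divr_ge0// ltW.
rewrite mulrA ler_pdivlMr//.
have ws0 : 0 < w s ^+ n by rewrite exprn_gt0.
rewrite -(ler_pM2r ws0) -(ler_pM2r D0).
apply: le_trans (_ : (A / 2) ^+ n.+1 * D ^+ n.+1 <= _); last first.
  by apply: (le_trans H); rewrite !mulrA [X in _ <= X]mulrAC.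
rewrite -!mulrA; apply: ler_wpM2l; first exact: exprn_ge0.
rewrite exprSr mulrA -exprMn; apply: ler_wpM2r; first exact: ltW.
by apply: lerXn2r => //; rewrite nnegrE ?mulr_ge0// ltW.
Qed.

(** The tail estimate is used twice: with gam = kap w(r) it gives D >= eta w(s) A, with gam = g(t)
    it gives A D^n <= C J^(n+1) w(s)^n. Inserting the first into the second cancels w(s)^n and
    leaves the power n + 1 of A. *)
Lemma integral_le_of_ratio (lam kap r1 : R) : 1 < lam -> 0 < kap ->
  (forall tau, 0 < tau -> tau <= w a -> kap * tau <= h tau) ->
  lam * s <= r1 -> s <= r1 -> r1 <= r ->
  (\int[leb R]_(x in `]r1, r]) (phi x)%:E = A%:E)%E ->
  forall C, C = (lam / (lam - 1)) ^+ n * n`!%:R ->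
  A <= (1 + C / (kap / (theta * C)) ^+ n) * (G (w s) - G (w r)).
Proof.
move=> lam1 kap0 Hkap lams sr1 r1r intA C CE; set J := G (w s) - G (w r).
set D := w s - w r.
have th0 : 0 < theta := lt_trans ltr01 theta_gt1.
have D0 : 0 <= D by rewrite subr_ge0.
have A0 : 0 <= A by rewrite -lee_fin -intA leb_integral_ge0.
have C0 : 0 < C.
  by rewrite CE mulr_gt0// exprn_gt0// divr_gt0 ?subr_gt0// (lt_trans ltr01).
have tail gam : 0 < gam -> (forall x, s <= x <= r -> gam <= h (w x)) -> gam * A <= C * D.
  move=> gam0 gamh; rewrite CE -mulrA.
  exact: (window_tail_le q_ge0 q_Linfty b_ge0 b_Linfty Q_ge w_sol w_gt0 a_gt0
    sigma_gt1 as_ sr rsigma r2 gam0 gamh mphi phi_ge0 phi_le lam1 lams sr1 r1r intA).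
(* The factor [theta] comes from replacing [w r] by [w s] through [wtheta]. *)
pose eta := kap / (theta * C).
have eta0 : 0 < eta by rewrite divr_gt0// mulr_gt0.
have AD : eta * w s * A <= D.
  have kw : 0 < kap * w r by rewrite mulr_gt0.
  have kwh x : s <= x <= r -> kap * w r <= h (w x).
    move=> /andP[sx xr]; have ax := le_trans as_ sx.
    apply: (le_trans (y := kap * w x)); first by rewrite ler_pM2l// w_ni.
    by apply: Hkap; [exact: w_gt0|exact: w_ni].
  have := tail _ kw kwh => H.
  have Ceta : C * eta = kap / theta by rewrite /eta; field; rewrite !gt_eqF.
  rewrite -(ler_pM2l C0) (le_trans _ H)//.
  have -> : C * (eta * w s * A) = C * eta * w s * A by ring.
  rewrite Ceta; apply: ler_wpM2r => //.
  by rewrite -mulrA ler_pM2l// mulrC ler_pdivrMr// mulrC ltW.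
(* Without any drop [AD] forces [A] to be 0; otherwise one factor [D] may be cancelled below. *)
have [D00|Dn0] := eqVneq D 0.
  have A00 : A <= 0.
    by have := AD; rewrite D00 pmulr_rle0// mulr_gt0.
  by rewrite (le_trans A00)// mulr_ge0// addr_ge0// divr_ge0 ?exprn_ge0// ltW.
have {Dn0}Dgt0 : 0 < D by rewrite lt_neqAle eq_sym Dn0.
have Y0 : 0 < C * D by rewrite mulr_gt0.
have := kernel_primitive_increase theta_gt1 h_gt0 h_cont g_int wr_gt0 wrs A0 Y0.
have Hg t : w r < t < w s -> A * g_fun theta h t <= C * D.
  by move=> rts; rewrite mulrC; apply: tail; [exact: g_gt0|exact: g_le_h].
move=> /(_ Hg); rewrite -/J -/D => H.
have en0 : 0 < eta ^+ n by rewrite exprn_gt0.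
apply: (@root_bound _ n) => //; first by rewrite divr_ge0 ?ltW.
rewrite -/eta mulrA ler_pdivlMr//.
have ws0 : 0 < w s ^+ n by rewrite exprn_gt0.
rewrite -(ler_pM2r ws0) -(ler_pM2r Dgt0).
apply: le_trans (_ : A * D ^+ n.+1 <= _); last first.
  by apply: (le_trans H); rewrite !mulrA [X in _ <= X]mulrAC.
rewrite exprS -!mulrA; apply: ler_wpM2l => //.
rewrite exprSr !mulrA -!exprMn; apply: ler_wpM2r; first exact: ltW.
have AE : A * eta * w s = eta * w s * A by ring.
apply: lerXn2r; rewrite ?nnegrE ?AE//.
by apply: mulr_ge0 => //; apply: mulr_ge0; exact: ltW.
Qed.

End Pair.

Section Chain.
Variables (rho th kap : R) (rk : nat -> R).
Hypotheses (rho_gt1 : 1 < rho) (rho_sigma : rho * rho < sigma) (rho_2 : rho * rho < 2).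
Hypotheses (th_gt1 : 1 < th) (th_theta : th * th < theta).
Hypotheses (kap_gt0 : 0 < kap) (kap_h : forall tau, 0 < tau -> tau <= w a -> kap * tau <= h tau).
Hypotheses (rk0 : rk 0%N = a) (rk_ge : forall k, a <= rk k).
Hypothesis rk_step : forall k, [/\ rk k < rk k.+1, rk k.+1 <= rho * rk k,
  w (rk k) <= th * w (rk k.+1) & rk k.+1 = rho * rk k \/ w (rk k) = th * w (rk k.+1)].

Lemma chain_le i j : (i <= j)%N -> rk i <= rk j.
Proof.
move=> /subnK <-; elim: (j - i)%N => [|k IH]; first by rewrite add0n.
by rewrite addSn (le_trans IH)//; have [/ltW] := rk_step (k + i).
Qed.

(* Every step raises [r / ((rho - 1) * a) - w r / ((1 - th^-1) * w M)] by at
   least one as long as the chain stays below M. *)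
Lemma chain_unbounded (M : R) : exists k, M < rk k.
Proof.
apply: contrapT => /forallNP nM.
have leM k : rk k <= M by rewrite leNgt; apply/negP; exact: nM.
have aM : a <= M by rewrite -rk0.
pose u := (rho - 1) * a; pose v := (1 - th^-1) * w M.
have u0 : 0 < u by rewrite mulr_gt0// subr_gt0.
have v0 : 0 < v by rewrite mulr_gt0 ?w_gt0// subr_gt0 invf_lt1// (lt_trans ltr01).
pose P k := rk k / u - w (rk k) / v.
have PS k : P k + 1 <= P k.+1.
  have [h1 h2 h3 h4] := rk_step k; rewrite /P.
  have wS : w (rk k.+1) <= w (rk k) by apply: w_ni => //; exact: ltW.
  case: h4 => [E|E].
    have : rk k / u + 1 <= rk k.+1 / u.
      rewrite -{1}(divff (lt0r_neq0 u0)) -mulrDl ler_pM2r ?invr_gt0// E /u.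
      have : (rho - 1) * a <= (rho - 1) * rk k by rewrite ler_pM2l// subr_gt0.
      lra.
    have : w (rk k.+1) / v <= w (rk k) / v by rewrite ler_pM2r ?invr_gt0.
    lra.
  have : w (rk k.+1) / v + 1 <= w (rk k) / v.
    rewrite -{1}(divff (lt0r_neq0 v0)) -mulrDl ler_pM2r ?invr_gt0// /v.
    have th0 : 0 < th := lt_trans ltr01 th_gt1.
    have wM : w M <= w (rk k) by apply: w_ni.
    have -> : w (rk k.+1) = th^-1 * w (rk k) by rewrite E mulrA mulVf ?mul1r// gt_eqF.
    have : (1 - th^-1) * w M <= (1 - th^-1) * w (rk k).
      by rewrite ler_pM2l// subr_gt0 invf_lt1.
    lra.
  have : rk k / u <= rk k.+1 / u by rewrite ler_pM2r ?invr_gt0// ltW.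
  lra.
have Pk k : P 0%N + k%:R <= P k.
  elim: k => [|k IH]; first by rewrite addr0.
  by rewrite -natr1 addrA (le_trans _ (PS k))// lerD2r.
have PM k : P k <= M / u.
  have : 0 <= w (rk k) / v by rewrite divr_ge0 ?ltW// w_gt0.
  have : rk k / u <= M / u by rewrite ler_pM2r ?invr_gt0.
  rewrite /P; lra.
have := archi_boundP (normr_ge0 (M / u - P 0%N)).
have := Pk (Num.bound `|M / u - P 0%N|); have := PM (Num.bound `|M / u - P 0%N|).
have := ler_norm (M / u - P 0%N).
lra.
Qed.

Variables (phi : R -> R) (K : R).
Hypothesis mphi : leb_measurable_fun setT phi.
Hypothesis phi_ge0 : forall x, 0 <= phi x.
Hypothesis phi_leK : forall x, phi x <= K.
Hypothesis phi_le : forall x, a <= x -> phi x <= weight x.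

Let I x y : R := fine (\int[leb R]_(z in `]x, y]) (phi z)%:E)%E.

Let mphi_sub x y : leb_measurable_fun `]x, y] phi.
Proof. by apply: measurable_funS mphi => //; exact: leb_measurable_itv. Qed.

Let IE x y : x <= y -> (\int[leb R]_(z in `]x, y]) (phi z)%:E = (I x y)%:E)%E.
Proof.
move=> xy; rewrite /I fineK//.
by have [] := @leb_integral_fin_num _ phi K x y xy (@mphi_sub x y) (fun y _ => phi_ge0 y)
  (leb_aeW (fun y _ => phi_leK y)).
Qed.

Let I_split x y z : x <= y -> y <= z -> I x z = I x y + I y z.
Proof.
move=> xy yz; have := @leb_integral_split _ phi x y z xy yz (@mphi_sub x z) (fun y _ => phi_ge0 y).
by rewrite !IE// ?(le_trans xy)// -EFinD => -[].
Qed.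

Let I_ge0 x y : 0 <= I x y.
Proof. by apply: fine_ge0; apply: leb_integral_ge0. Qed.

Let C1 := 2 * (1 + n`!%:R / (1 - th^-1) ^+ n).
Let C2 := (rho / (rho - 1)) ^+ n * n`!%:R.
Let C3 := C1 + (1 + C2 / (kap / (theta * C2)) ^+ n).

Let C2_gt0 : 0 < C2.
Proof.
by rewrite mulr_gt0// exprn_gt0// divr_gt0 ?subr_gt0// (lt_trans ltr01).
Qed.

Let C1_ge0 : 0 <= C1.
Proof.
rewrite mulr_ge0// addr_ge0// divr_ge0 ?ltW// exprn_gt0//.
by rewrite subr_gt0 invf_lt1// (lt_trans ltr01).
Qed.

Let C3_ge0 : 0 <= 1 + C2 / (kap / (theta * C2)) ^+ n.
Proof.
rewrite addr_ge0// divr_ge0 ?ltW// exprn_gt0// divr_gt0// mulr_gt0//.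
exact: lt_trans theta_gt1.
Qed.

(** Only the type of the first step matters. If it multiplied the radius by [rho], the second step
    lies in the tail of the window; if it divided [w] by [th], the whole window has the required
    drop. The bounds on [rho * rho] and [th * th] make two steps an admissible window. *)
Lemma chain_pair_le k :
  I (rk k.+1) (rk k.+2) <= C3 * (G (w (rk k)) - G (w (rk k.+2))).
Proof.
have [s1 s2 s3 s4] := rk_step k; have [t1 t2 t3 _] := rk_step k.+1.
have sr : rk k < rk k.+2 := lt_trans s1 t1.
have rk_gt0 : 0 < rk k := lt_le_trans a_gt0 (rk_ge k).
have rho0 : 0 < rho := lt_trans ltr01 rho_gt1.
have rr : rk k.+2 <= rho * rho * rk k.
  by rewrite (le_trans t2)// -mulrA ler_pM2l.
have rsig : rk k.+2 <= sigma * rk k by rewrite (le_trans rr)// ler_pM2r// ltW.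
have r2 : rk k.+2 <= 2 * rk k by rewrite (le_trans rr)// ler_pM2r// ltW.
have wr0 : 0 < w (rk k.+2) by apply: w_gt0.
have wth : w (rk k) < theta * w (rk k.+2).
  apply: (@le_lt_trans _ _ (th * th * w (rk k.+2))); last by rewrite ltr_pM2r.
  by rewrite (le_trans s3)// -mulrA ler_pM2l// (lt_trans ltr01).
have J0 : 0 <= G (w (rk k)) - G (w (rk k.+2)).
  by rewrite subr_ge0 G_le// ?(ltW wr0)//; apply: w_ni => //; exact: ltW.
case: s4 => E.
  have := @integral_le_of_ratio phi (I (rk k.+1) (rk k.+2)) (rk k) (rk k.+2) mphi phi_ge0 phi_le
    (rk_ge k) sr rsig r2 wth rho kap (rk k.+1) rho_gt1 kap_gt0 kap_h.
  rewrite -E => /(_ (lexx _) (ltW s1) (ltW t1) (IE (ltW t1)) C2 erefl) H.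
  by rewrite (le_trans H)// ler_wpM2r// lerDr.
have d0 : 0 < 1 - th^-1 by rewrite subr_gt0 invf_lt1// (lt_trans ltr01).
have dle : (1 - th^-1) * w (rk k) <= w (rk k) - w (rk k.+2).
  rewrite mulrBl mul1r lerD2l lerN2 E mulrA mulVf ?mul1r; last first.
    by rewrite gt_eqF// (lt_trans ltr01).
  by apply: w_ni => //; exact: ltW.
have H := @integral_le_of_drop phi K (I (rk k) (rk k.+2)) (rk k) (rk k.+2) mphi phi_ge0 phi_leK
    phi_le (rk_ge k) sr rsig r2 wth (1 - th^-1) d0 dle (IE (ltW sr)).
apply: (@le_trans _ _ (I (rk k) (rk k.+2))).
  by rewrite (I_split (ltW s1) (ltW t1)) lerDr.
by rewrite (le_trans H)// ler_wpM2r// lerDl.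
Qed.

(** Consecutive windows share a step, so the differences of [G] telescope to two initial minus two
    final terms. The first step is the second half of no window and stays on the right. *)
Lemma chain_integral_le k : I a (rk k.+1) <= I a (rk 1%N) + C3 * (2 * G (w a)).
Proof.
have C30 : 0 <= C3 by rewrite addr_ge0.
have G0 x : 0 <= G x by exact: kernel_primitive_ge0.
have Gw : G (w (rk 1%N)) <= G (w a) by apply: G_le; [rewrite ltW// w_gt0|exact: w_ni].
suff : I a (rk k.+1) <= I a (rk 1%N) +
    C3 * (G (w a) + G (w (rk 1%N)) - G (w (rk k)) - G (w (rk k.+1))).
  move=> /le_trans; apply; rewrite lerD2l; apply: ler_wpM2l => //.
  have := G0 (w (rk k)); have := G0 (w (rk k.+1)); lra.
elim: k => [|k IH]; first by rewrite rk0; lra.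
have [/ltW s1 _ _ _] := rk_step k.+1.
rewrite (I_split (rk_ge k.+1) s1).
have := chain_pair_le k; lra.
Qed.

End Chain.

Hypothesis f_int : (\int[leb R]_(xi in `[a, +oo[) (weight xi)%:E = +oo)%E.

Lemma no_positive_solution : False.
Proof.
have [rho rho1] : exists2 rho, 1 < rho & rho * rho < Num.min sigma 2.
  by apply: exists_sqrt_below; rewrite lt_min sigma_gt1 ltr1n.
rewrite lt_min => /andP[rhos rho2].
have [th th1 tht] := exists_sqrt_below theta_gt1.
have [kap kap0 kaph] := h_ge_linear theta_gt1 h_gt0 h_cont g_int (w a).
have cw x y : a <= x -> x <= y -> {within `[x, y], continuous w}.
  move=> ax xy; apply: ac_continuous; have [_ acw _ _] := w_sol.
  exact: (acw 0%N isT x y ax xy).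
have [step stepP] : {step : R -> R & forall s, a <= s -> [/\ s < step s, step s <= rho * s,
    w s <= th * w (step s) & step s = rho * s \/ w s = th * w (step s)]}.
  apply: (@choice _ _ (fun s r => a <= s -> [/\ s < r, r <= rho * s,
    w s <= th * w r & r = rho * s \/ w s = th * w r])) => s.
  have [as_|nas] := pselect (a <= s); last by exists 0.
  by have [r Hr] := step_exists a_gt0 rho1 th1 cw w_ni w_gt0 as_; exists r.
pose rk k := iter k step a.
have rk_ge k : a <= rk k.
  by elim: k => [//|k IH]; rewrite /rk iterS (le_trans IH)//; have [/ltW] := stepP _ IH.
have rk_step k : [/\ rk k < rk k.+1, rk k.+1 <= rho * rk k,
    w (rk k) <= th * w (rk k.+1) & rk k.+1 = rho * rk k \/ w (rk k) = th * w (rk k.+1)].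
  exact: stepP (rk_ge k).
have [_ /(_ a (rk 1%N) (lexx a) (rk_ge 1%N))[M aeM]] := q_Linfty.
(* [C0] bounds the integral over the first step for every [phi] below the weight, so that [phi] can
   be chosen after all the constants. *)
pose C0 := `|rk 1%N ^+ n * M| * (rk 1%N - a).
pose C1 := 2 * (1 + n`!%:R / (1 - th^-1) ^+ n).
pose C2 := (rho / (rho - 1)) ^+ n * n`!%:R.
pose C3 := C1 + (1 + C2 / (kap / (theta * C2)) ^+ n).
have wge x (ax : a <= x) := weight_le_q q_ge0 b_ge0 sigma a_gt0 ax.
have [phi [mphi phi0 [K phiK] phiw [k Ck]]] := @infinite_integral_simple _ a
  (C0 + C3 * (2 * G (w a))) _ rk (fun x ax => proj1 (andP (wge x ax))) f_int
  (chain_le rk_step) (chain_unbounded rho1 th1 erefl rk_ge rk_step).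
have mphi_sub x y : leb_measurable_fun `]x, y] phi.
  by apply: measurable_funS mphi => //; exact: leb_measurable_itv.
have fin := leb_integral_fin_num (rk_ge _) (mphi_sub _ _) (fun y _ => phi0 y).
have first : fine (\int[leb R]_(x in `]a, rk 1%N]) (phi x)%:E)%E <= C0.
  have [|le fn] := fin (rk 1%N ^+ n * M) 1%N; last by rewrite -lee_fin fineK.
  apply: leb_aeS aeM => x H /andP[ax xr].
  have /andP[_ wq] := wge x (ltW ax).
  have x0 : 0 <= x by rewrite ltW// (lt_trans a_gt0).
  have qM : q x <= M by rewrite (le_trans (ler_norm _))// H// !ltW.
  rewrite (le_trans (phiw x (ltW ax)))// (le_trans wq)//.
  apply: ler_pM; [exact: exprn_ge0|exact: q_ge0 (ltW ax)| |exact: qM].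
  by apply: lerXn2r; rewrite ?nnegrE ?(ltW xr) ?(le_trans x0 (ltW xr)).
have := chain_integral_le rho1 rhos rho2 th1 tht kap0 kaph erefl rk_ge rk_step
  mphi phi0 phiK phiw k.
have [_ fnk] := fin K k (leb_aeW (fun y _ => phiK y)).
have [_ fnk1] := fin K k.+1 (leb_aeW (fun y _ => phiK y)).
apply/negP; rewrite -ltNge.
move: Ck; rewrite -(fineK fnk) lte_fin -/C1 -/C2 -/C3 => Ck.
apply: (@le_lt_trans _ _ (C0 + C3 * (2 * G (w a)))); first by rewrite lerD2r.
apply: (lt_le_trans Ck); apply: fine_le => //.
(* The chain bound reaches [rk k.+1], one step beyond the point where [phi] has exceeded the
   constant. *)
have [/ltW s1 _ _ _] := rk_step k.
rewrite [leRHS](leb_integral_split (rk_ge k) s1)//.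
by rewrite leeDl// leb_integral_ge0.
Qed.

End NoPositiveSolution.

Theorem theorem2p1 (R : realType) (m : nat) (a theta sigma : R)
    (Q : R -> 'rV[R]_m -> R) (q : R -> R) (b : nat -> R -> R) (h : R -> R)
    (m_ge2 : (2 <= m)%N) (a_gt0 : 0 < a)
    (theta_gt1 : 1 < theta) (sigma_gt1 : 1 < sigma)
    (Q_Car : Caratheodory_loc a Q)
    (q_ge0 : forall r, a <= r -> 0 <= q r) (q_Linfty : Linfty_loc a q)
    (b_ge0 : forall i r, (1 <= i < m)%N -> a <= r -> 0 <= b i r)
    (b_Linfty : forall i, (1 <= i < m)%N -> Linfty_loc a (b i))
    (h_gt0 : forall t, 0 < t -> 0 < h t)
    (h_cont : {within `]0, +oo[, continuous h})
    (Q_ge : forall (r : R) (t : nat -> R), a <= r -> 0 < t 0%N ->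
      (forall i, (1 <= i < m)%N -> 0 <= (-1) ^+ i * t i) ->
      (-1) ^+ m * Q r (\row_(i < m) t i) >=
        q r * h (t 0%N) - \sum_(1 <= i < m) b i r * `|t i|)
    (g_int : (\int[leb R]_(t in `]0%R, 1%R[)
       (g_fun theta h t `^ (- m%:R^-1) * t `^ (m%:R^-1 - 1))%:E < +oo)%E)
    (f_int : (\int[leb R]_(xi in `[a, +oo[)
       (xi ^+ m.-1 * f_fun m a sigma q b xi *
        mu_fun m a sigma q b xi `^ (m%:R^-1 - 1))%:E = +oo)%E)
    (w : R -> R) :
  nontrivial a w -> is_solution a Q w -> singular_first_kind a w.
Proof.
move=> nt sol; split => //; have [_ _ _ sgw] := sol.
have w_ge0 r : a <= r -> 0 <= w r.
  by move=> ar; have := sgw 0%N r (ltnW m_ge2) ar; rewrite expr0 mul1r.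
(* A nonnegative nonincreasing function stays 0 after its first zero, so only a solution without
   zeros has to be excluded. *)
have [[s as_ ws0]|nz] := pselect (exists2 s, a <= s & w s = 0).
  exists s; split; first exact: num_real.
  move=> r /ltW sr; apply/eqP; rewrite eq_le w_ge0 ?(le_trans as_ sr)// andbT.
  by rewrite -ws0; exact: (solution_nonincreasing m_ge2 sol as_ sr).
have w_gt0 r : a <= r -> 0 < w r.
  move=> ar; rewrite lt_neqAle w_ge0// andbT; apply/eqP => w0.
  by apply: nz; exists r.
case: m m_ge2 Q Q_ge b_ge0 b_Linfty g_int f_int sol {Q_Car sgw} =>
  [//|n] n_gt0 Q' Q_ge' b_ge0' b_Linfty' g_int' f_int' sol'.
by case: (no_positive_solution n_gt0 a_gt0 theta_gt1 sigma_gt1 q_ge0 q_Linfty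
  b_ge0' b_Linfty' h_gt0 h_cont Q_ge' sol' w_gt0 g_int' f_int').
Qed.
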